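(* Let AS.1 and AS.4 hold, and let the sequence $\{x_k\}$ generated by Algorithm P be bounded, so that there are positive constants $\kappa_f,\kappa_c,\kappa_g,\kappa_J$ with $f(x_k)\le\kappa_f$, $\|c(x_k)\|\le\kappa_c$, $\|\nabla f(x_k)\|\le\kappa_g$, $\|J(x_k)\|\le\kappa_J$ for all $k$. Assume that at each iteration of Algorithm P, Algorithm S is called to solve the subproblem $\min_{x\in\mathbb R^n}\Phi_\rho(x)$ for fixed $\rho$ (with $\rho=\rho_k$ and starting point $x_k$ at iteration $k$), with stepsize $\gamma=\gamma_\rho:=1/L_\rho$, $L_\rho:=L_g+\rho L_J$, with the number of oracle calls $\bar N_\rho$ satisfying $$\bar N_\rho\ \ge\ \max\left\{\frac{(4D_{\Phi_\rho}C_2+4L_\rho C_3)^2}{\epsilon^2}+\frac{128L_\rho D_{\Phi_\rho}}{\epsilon},\ \frac{C_1}{L_\rho^2}\right\},$$ where $C_1=\sigma^2/\tilde D$, $C_2=8\sigma/\sqrt{\tilde D}$, $C_3=6\sigma\sqrt{\tilde D}$ with $\tilde D$ some problem-independent positive constant, and $D_{\Phi_\rho}:=\Phi_\rho(x_k)-\Phi_\rho^{low}$, and with batch sizes chosen as $$m_\rho=\left\lceil\min\left\{\bar N_\rho,\ \max\left\{1,\frac{\sigma}{L_\rho}\sqrt{\frac{\bar N_\rho}{\tilde D}}\right\}\right\}\right\rceil .$$ Then Algorithm P returns $x_N$ which satisfies $$\mathbb E[\theta(x_N)]\le \frac{2\bar C+(2\bar C)^{1/2}(L_g+L_J)^{1/2}}{\xi(\rho_0+(N-1)\tau)^{1/2}}\,\epsilon^{1/4}+\frac{(\kappa_g^2+0.25\epsilon)^{1/2}}{(1-\xi)(\rho_0+(N-1)\tau)}$$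 and $$\mathbb E[\|\nabla f(x_N)+J(x_N)^T\lambda_N\|^2]\le\epsilon\quad\text{for some }\lambda_N\in\mathbb R^q,$$ where $\bar C=\frac{1}{L_J}\kappa_J+\frac1{L_g}(\kappa_g^2+0.25\epsilon)^{1/2}$ and the expectations are taken with respect to all the random variables generated in the process of Algorithm P. Consequently, if $N$ is set as $$N\ \ge\ \hat N:=\left\lceil \tau^{-1}\tilde C\epsilon^{-1/2}-\tau^{-1}\rho_0+1\right\rceil,$$ where $\tilde C=\max\left\{(4\bar C+(8\bar C)^{1/2}(L_g+L_J)^{1/2})^2\xi^{-2},\ (4\kappa_g^2+\epsilon)^{1/2}(1-\xi)^{-1}\right\}$, then Algorithm P returns an $\epsilon$-stochastic critical point of the problem $\min\{f(x): c(x)=0\}$. Moreover, Algorithm P finds an $\epsilon$-stochastic critical point of this problem after at most $O(\epsilon^{-3.5})$ calls to the stochastic first-order oracle.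
   Context: Problem: $\min_{x\in\mathbb R^n} f(x)$ subject to $c(x)=0$, with $f:\mathbb R^n\to\mathbb R$, $c=(c_1,\dots,c_q)^T:\mathbb R^n\to\mathbb R^q$, both possibly nonconvex. $\|\cdot\|$ is the Euclidean norm (induced norm for matrices) and $J(x)=(\nabla c_1(x),\dots,\nabla c_q(x))^T$ is the Jacobian of $c$. AS.1: $f$ and all $c_i$ are continuously differentiable; $f(x)\ge f^{low}$ for all $x$, with $f^{low}\in\mathbb R$; $\nabla f$ and $J$ are Lipschitz continuous with constants $L_g$ and $L_J$ respectively. Stochastic first-order oracle: for input $x$ it outputs a stochastic gradient $G(x,\zeta)\in\mathbb R^n$ of $f$, where $\zeta$ is a random variable whose distribution has support not depending on $x$. AS.4: for every iterate $x_k$ and sample $\zeta_k$, $\mathbb E[G(x_k,\zeta_k)]=\nabla f(x_k)$ and $\mathbb E[\|G(x_k,\zeta_k)-\nabla f(x_k)\|^2]\le\sigma^2$, where $\sigma>0$. For $\rho>0$: $\Phi_\rho(x)=f(x)+\rho\|c(x)\|$, and $\Phi_\rho^{low}\ge f^{low}$ is a real number with $\Phi_\rho(x)\ge\Phi_\rho^{low}$ for all $x$. $\theta(x)=\|c(x)\|-\min_{\|s\|\le1}\|c(x)+J(x)s\|$. $\epsilon$-stochastic critical point: the output $x$ of a random process such that there exists $\lambda\in\mathbb R^q$ (which may depend on the outcome of the random process) with $\mathbb E[\|\nabla f(x)+J(x)^T\lambda\|^2]\le\epsilon$ and $\mathbb E[\theta(x)]\le\sqrt\epsilon$. Algorithm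 S (stochastic approximation for minimizing $\Phi_\rho$, with starting point $y_1$, constant stepsize $\gamma$, constant batch size $m$, total number of oracle calls $\bar N$): the maximum number of iterations is $N_{in}=\lceil \bar N/m\rceil$, and $R$ is a random variable on $\{1,\dots,N_{in}\}$ with $\mathrm{Prob}\{R=j\}$ proportional to $\gamma-L_\rho\gamma^2/2$, i.e. uniform for constant stepsize. For $j=1,\dots,R-1$: call the oracle $m$ times at $y_j$, let $G_j$ be the average of the $m$ answers, and set $$y_{j+1}=\operatorname{argmin}_{u\in\mathbb R^n}\left\{G_j^T(u-y_j)+\rho\|c(y_j)+J(y_j)(u-y_j)\|+\tfrac1{2\gamma}\|u-y_j\|^2\right\}.$$ The output is $y_R$, together with $G_R$, the average of $m$ oracle answers formed in the same way at $y_R$. Put $\tilde g^r_R=\frac1\gamma(y_R-y_R^+)$, where $y_R^+$ is the minimizer in the displayed problem with $j=R$. Algorithm P (penalty method): given the maximum iteration number $N$, tolerance $\epsilon\in(0,1)$, steering parameter $\xi\in(0,1)$, $x_1\in\mathbb R^n$, $G_1\in\mathbb R^n$, initial penalty parameter $\rho_0\ge1$, minimal increase factor $\tau>0$. For $k=1,\dots,N-1$: (a) find $\rho=\rho_k\ge\rho_{k-1}+\tau$ satisfying $\phi_{\rho}(x_k)\ge\rho\,\xi\,\theta(x_k)$, where $\phi_\rho(x_k)=\rho\|c(x_k)\|-\min_{\|s\|\le1}\{G_k^Ts+\rho\|c(x_k)+J(x_k)s\|\}$; (b) apply Algorithm S with starting point $x_k$ to $\min_x\Phi_{\rho_k}(x)$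 using $\bar N_{\rho_k}$ oracle calls, returning $x_{k+1}:=y_R$ and $G_{k+1}:=G_R$ such that $\mathbb E[\|\tilde g_R^r\|^2]\le\epsilon$ (expectation over the random variables generated in this call of Algorithm S). The output is $x_N$.
   Formalization: N ≥ 2 is assumed (for N = 1 the output is the arbitrary x_1); the O(ε^{-3.5}) bound takes N = max(2, N̂), N̄_ρ the least integer allowed, and ρ_k ≤ Bε^{-1/2} almost surely for a constant B, since arbitrarily large N̄_ρ or ρ_k would make it false. *)

(* Defs.v *)
From HB Require Import structures.
From mathcomp Require Import all_boot all_order all_algebra.
From mathcomp Require Import all_classical all_reals all_analysis.

Set Implicit Arguments.
Unset Strict Implicit.
Unset Printing Implicit Defensive.

Import Order.TTheory GRing.Theory Num.Theory.
Import numFieldNormedType.Exports.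

Local Open Scope classical_set_scope.
Local Open Scope ring_scope.

(** The problem is to minimize f subject to c = 0.  Algorithm S is a stochastic
    proximal-linear method for the exact penalty function [Phi rho], stopped
    at a random index; Algorithm P is the penalty method that calls it for
    increasing values of rho.

    Vectors of R^n are row vectors.  ['J c x] is the library's Jacobian, which
    acts on the right of row vectors: the J(x)s of column-vector notation is
    [s *m 'J c x], and J(x)^T lambda is [lambda *m ('J c x)^T]. *)

Section Euclidean.
Context {R : realType}.

Definition dot n (u v : 'rV[R]_n) : R := \sum_i u ord0 i * v ord0 i.

(* The library's norm on matrices is the max norm, hence this definition. *)
Definition enorm n (u : 'rV[R]_n) : R := Num.sqrt (dot u u).

(* Norm induced by [enorm]; it is the same for a matrix and its transpose. *)
Definition opnorm n q (A : 'M[R]_(n, q)) : R :=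
  sup [set enorm (s *m A) | s in [set s : 'rV[R]_n | enorm s <= 1]].

Definition grad n (f : 'rV[R]_n -> R) (x : 'rV[R]_n) : 'rV[R]_n :=
  \row_j 'D_(delta_mx ord0 j) f x.

Definition is_argmin (T : Type) (F : T -> R) (u : T) : Prop :=
  forall v, F u <= F v.

(* Ceiling as a natural number, for nonnegative arguments. *)
Definition natceil (r : R) : nat := `|Num.ceil r|%N.

(* R^n with its Borel sigma-algebra. *)
Definition borelRn n : measurableType _ :=
  g_sigma_algebraType (@open 'rV[R]_n).

End Euclidean.
Arguments borelRn R n : clear implicits.

Section Problem.
Context {R : realType} (n q : nat).
Variables (f : 'rV[R]_n -> R) (c : 'rV[R]_n -> 'rV[R]_q).

Record AS1 (flow Lg LJ : R) : Prop := {
  AS1_df : forall x, differentiable f x;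
  AS1_dc : forall x, differentiable c x;
  AS1_cgrad : continuous (grad f);
  AS1_cjac : continuous (jacobian c);
  AS1_low : forall x, flow <= f x;
  AS1_Lg : forall x y, enorm (grad f x - grad f y) <= Lg * enorm (x - y);
  AS1_LJ : forall x y, opnorm ('J c x - 'J c y) <= LJ * enorm (x - y) }.

Definition Phi (rho : R) (x : 'rV[R]_n) : R := f x + rho * enorm (c x).

(* The infima in [theta] and [phi] are minima: continuous functions on the
   closed unit ball. *)
Definition theta (x : 'rV[R]_n) : R :=
  enorm (c x) - inf [set enorm (c x + s *m 'J c x)
                    | s in [set s : 'rV[R]_n | enorm s <= 1]].

Definition phi (rho : R) (x g : 'rV[R]_n) : R :=
  rho * enorm (c x) - inf [set dot g s + rho * enorm (c x + s *m 'J c x)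
                          | s in [set s : 'rV[R]_n | enorm s <= 1]].

(* Objective of the proximal subproblem of Algorithm S at the point [x] with
   gradient estimate [g]. *)
Definition prox_obj (rho gamma : R) (x g u : 'rV[R]_n) : R :=
  dot g (u - x) + rho * enorm (c x + (u - x) *m 'J c x)
  + (2 * gamma)^-1 * enorm (u - x) ^+ 2.

Section Criticality.
Context {d} {Omega : measurableType d} (P : probability Omega R).
Local Open Scope ereal_scope.

Definition dual_feasible (eps : R) (X : Omega -> 'rV[R]_n) : Prop :=
  exists lambda : Omega -> 'rV[R]_q,
    measurable_fun setT (lambda : Omega -> borelRn R q) /\
    'E_P[fun w => (enorm (grad f (X w) + lambda w *m ('J c (X w))^T) ^+ 2)%R]
      <= eps%:E.

Definition stoch_critical (eps : R) (X : Omega -> 'rV[R]_n) : Prop :=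
  dual_feasible eps X /\ 'E_P[fun w => theta (X w)] <= (Num.sqrt eps)%:E.

End Criticality.

Section Oracle.
Context {dX} {Xi : measurableType dX}.

(** The stochastic first-order oracle: on input [x] it draws zeta in the
    space [Xi], which does not depend on [x], according to [oracle_law x], and
    answers [oracle_grad x zeta].  A law that does not depend on [x] is a
    constant kernel. *)
Record oracle := Oracle {
  oracle_law : R.-pker (borelRn R n) ~> Xi;
  oracle_grad : 'rV[R]_n -> Xi -> 'rV[R]_n;
  oracle_meas : measurable_fun [set: borelRn R n * Xi]
    ((fun p => oracle_grad p.1 p.2) : borelRn R n * Xi -> borelRn R n) }.

Definition unbiased_at (o : oracle) (sigma : R) (x : 'rV[R]_n) : Prop :=
  [/\ (forall i, \int[oracle_law o x]_z (oracle_grad o x z ord0 i)%:E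
         = (grad f x ord0 i)%:E)%E
    & (\int[oracle_law o x]_z (enorm (oracle_grad o x z - grad f x) ^+ 2)%:E
         <= (sigma ^+ 2)%:E)%E ].

Context {d} {Omega : measurableType d} (P : probability Omega R).

(** The random variables of a run of Algorithm P, outer iterations [k] and
    inner iterations [j] being numbered from 1, and the samples [i] of a batch
    from 0.  Although Algorithm S stops at [y k (R_ k)], the sequence [y k j]
    and its samples are continued for all [j], so that the random index [R_ k]
    can be said to be independent of them; the oracle calls made after [R_ k]
    are fictitious and are not counted in [oracle_calls]. *)
Record trajectory := Trajectory {
  x_ : nat -> Omega -> 'rV[R]_n;
  G_ : nat -> Omega -> 'rV[R]_n;
  rho_ : nat -> Omega -> R;
  Nbar_ : nat -> Omega -> nat;
  R_ : nat -> Omega -> nat;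
  y_ : nat -> nat -> Omega -> 'rV[R]_n;
  zeta_ : nat -> nat -> nat -> Omega -> Xi }.

Definition events {d'} {T : measurableType d'} (X : Omega -> T) :
  set_system Omega := preimage_set_system setT X measurable.

(* Generators of the sigma-algebra of what is known when the [k]-th call of
   Algorithm S starts. *)
Definition past (t : trajectory) (k : nat) : set_system Omega :=
  (\bigcup_(l in [set l | (0 < l <= k)%N])
     (events (rho_ t l) `|` events (Nbar_ t l))) `|`
  (\bigcup_(l in [set l | (0 < l < k)%N])
     (events (R_ t l) `|`
      \bigcup_(j in [set j | (0 < j)%N])
        (events (y_ t l j : Omega -> borelRn R n) `|`
         \bigcup_i events (zeta_ t l j i)))).

(* Idem, just before the [i]-th sample at [y_ t k j] is drawn. *)
Definition past_sample (t : trajectory) (k j i : nat) : set_system Omega :=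
  past t k `|`
  (\bigcup_(j' in [set j' | (0 < j' <= j)%N])
     events (y_ t k j' : Omega -> borelRn R n)) `|`
  (\bigcup_(p in [set p : nat * nat | (0 < p.1)%N /\
                    ((p.1 < j)%N \/ p.1 = j /\ (p.2 < i)%N)])
     events (zeta_ t k p.1 p.2)).

(* Idem, with all the samples of the [k]-th call of Algorithm S. *)
Definition past_call (t : trajectory) (k : nat) : set_system Omega :=
  past t k `|`
  (\bigcup_(j in [set j | (0 < j)%N])
     (events (y_ t k j : Omega -> borelRn R n) `|`
      \bigcup_i events (zeta_ t k j i))).

(** Stepsize [gamma rho] and batch size [batch rho Nbar]. *)
Variables (o : oracle) (gamma : R -> R) (batch : R -> nat -> nat).

Definition m_ (t : trajectory) (k : nat) (w : Omega) : nat :=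
  batch (rho_ t k w) (Nbar_ t k w).

Definition Nin (t : trajectory) (k : nat) (w : Omega) : nat :=
  natceil ((Nbar_ t k w)%:R / (m_ t k w)%:R : R).

Definition Gbar (t : trajectory) (k j : nat) (w : Omega) : 'rV[R]_n :=
  (m_ t k w)%:R^-1 *:
    \sum_(i < m_ t k w) oracle_grad o (y_ t k j w) (zeta_ t k j i w).

(* As the sequence [y_ t k] is continued beyond [R_ t k], its next element is
   the minimizer y_R^+. *)
Definition gtilde (t : trajectory) (k : nat) (w : Omega) : 'rV[R]_n :=
  (gamma (rho_ t k w))^-1 *:
    (y_ t k (R_ t k w) w - y_ t k (R_ t k w).+1 w).

(** The [k]-th call of Algorithm S.  Given what happened before, each sample
    has the oracle's law at the current point, and the random index is
    uniform on 1, ..., [Nin], independently of the samples of the call. *)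
Record algS (t : trajectory) (k : nat) : Prop := {
  algS_meas_y : forall j, (0 < j)%N ->
    measurable_fun setT (y_ t k j : Omega -> borelRn R n);
  algS_meas_zeta : forall j i, (0 < j)%N -> measurable_fun setT (zeta_ t k j i);
  algS_meas_R : measurable_fun setT (R_ t k);
  algS_init : forall w, y_ t k 1 w = x_ t k w;
  algS_step : forall j w, (0 < j)%N ->
    is_argmin (prox_obj (rho_ t k w) (gamma (rho_ t k w))
                        (y_ t k j w) (Gbar t k j w))
              (y_ t k j.+1 w);
  algS_sample : forall j i A B, (0 < j)%N ->
    <<s past_sample t k j i >> A -> measurable B ->
    P (A `&` zeta_ t k j i @^-1` B)
      = (\int[P]_(w in A) oracle_law o (y_ t k j w) B)%E;
  algS_range : forall w, (0 < R_ t k w <= Nin t k w)%N;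
  algS_index : forall j A, <<s past_call t k >> A ->
    P (A `&` [set w | R_ t k w = j])
      = (\int[P]_(w in A)
           (if (0 < j <= Nin t k w)%N then (Nin t k w)%:R^-1 else 0)%:E)%E }.

(** [t] is a run of Algorithm P with [N - 1] calls of Algorithm S. The conditional expectation in
    [algP_gtilde], over the random variables of the [k]-th call, is expressed
    by integration over the events known at the start of the call. *)
Record algP (N : nat) (eps xi tau rho0 : R) (x1 G1 : 'rV[R]_n)
    (t : trajectory) : Prop := {
  algP_x1 : forall w, x_ t 1 w = x1;
  algP_G1 : forall w, G_ t 1 w = G1;
  algP_rho0 : forall w, rho_ t 0 w = rho0;
  algP_meas_rho : forall k, (0 < k < N)%N -> measurable_fun setT (rho_ t k);
  algP_meas_Nbar : forall k, (0 < k < N)%N -> measurable_fun setT (Nbar_ t k);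
  algP_rho : forall k w, (0 < k < N)%N ->
    rho_ t k.-1 w + tau <= rho_ t k w;
  algP_steer : forall k w, (0 < k < N)%N ->
    rho_ t k w * xi * theta (x_ t k w)
      <= phi (rho_ t k w) (x_ t k w) (G_ t k w);
  algP_algS : forall k, (0 < k < N)%N -> algS t k;
  algP_x : forall k w, (0 < k < N)%N -> x_ t k.+1 w = y_ t k (R_ t k w) w;
  algP_G : forall k w, (0 < k < N)%N -> G_ t k.+1 w = Gbar t k (R_ t k w) w;
  algP_gtilde : forall k A, (0 < k < N)%N -> <<s past t k >> A ->
    (\int[P]_(w in A) (enorm (gtilde t k w) ^+ 2)%:E <= eps%:E * P A)%E }.

(* The oracle assumption at every iterate, those of Algorithm S included. *)
Definition AS4 (sigma : R) (N : nat) (t : trajectory) : Prop :=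
  forall k j w, (0 < k < N)%N -> (0 < j <= Nin t k w)%N ->
    unbiased_at o sigma (y_ t k j w).

Definition bounded_iterates (kf kc kg kJ : R) (N : nat) (t : trajectory) :
  Prop :=
  (exists M : R, {ae P, forall w, forall k, (0 < k <= N)%N ->
     enorm (x_ t k w) <= M}) /\
  {ae P, forall w, forall k, (0 < k <= N)%N ->
     [/\ f (x_ t k w) <= kf, enorm (c (x_ t k w)) <= kc,
         enorm (grad f (x_ t k w)) <= kg & opnorm ('J c (x_ t k w)) <= kJ]}.

(* [R_] batches in the [k]-th call: at y_1, ..., y_(R-1) and at y_R. *)
Definition oracle_calls (N : nat) (t : trajectory) (w : Omega) : nat :=
  \sum_(1 <= k < N) R_ t k w * m_ t k w.

End Oracle.
End Problem.

Arguments oracle R n {dX} Xi.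
Arguments trajectory R n {dX} Xi {d} Omega.

Section Constants.
Context {R : realType}.
Variables (Lg LJ sigma Dt : R).

Definition L_ (rho : R) : R := Lg + rho * LJ.

Definition C1 : R := sigma ^+ 2 / Dt.
Definition C2 : R := 8 * sigma / Num.sqrt Dt.
Definition C3 : R := 6 * sigma * Num.sqrt Dt.

(* Lower bound on the number of oracle calls; [D] stands for D_Phi_rho. *)
Definition Nbar_min (eps rho D : R) : R :=
  Num.max ((4 * D * C2 + 4 * L_ rho * C3) ^+ 2 / eps ^+ 2
             + 128 * L_ rho * D / eps)
          (C1 / L_ rho ^+ 2).

Definition batch_size (rho : R) (Nbar : nat) : nat :=
  natceil (Num.min Nbar%:R
             (Num.max 1 (sigma / L_ rho * Num.sqrt (Nbar%:R / Dt)))).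

Variables (kg kJ xi tau rho0 eps : R).

Definition Cbar : R := LJ^-1 * kJ + Lg^-1 * Num.sqrt (kg ^+ 2 + eps / 4).

Definition Ctilde : R :=
  Num.max
    ((4 * Cbar + Num.sqrt (8 * Cbar) * Num.sqrt (Lg + LJ)) ^+ 2 / xi ^+ 2)
    (Num.sqrt (4 * kg ^+ 2 + eps) / (1 - xi)).

Definition Nhat : int :=
  Num.ceil (tau^-1 * Ctilde * eps `^ (- (1 / 2)) - tau^-1 * rho0 + 1).

Definition theta_bound (N : nat) : R :=
  let rhoN := rho0 + (N%:R - 1) * tau in
  (2 * Cbar + Num.sqrt (2 * Cbar) * Num.sqrt (Lg + LJ)) / (xi * Num.sqrt rhoN)
    * eps `^ (1 / 4)
  + Num.sqrt (kg ^+ 2 + eps / 4) / ((1 - xi) * rhoN).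

End Constants.

(* Main.v *)
Require Import Defs.
From HB Require Import structures.
From mathcomp Require Import all_boot all_order all_algebra.
From mathcomp Require Import all_classical all_reals all_analysis.
From mathcomp Require Import measurable_realfun ring lra.

Set Implicit Arguments.
Unset Strict Implicit.
Unset Printing Implicit Defensive.

Import Order.TTheory GRing.Theory Num.Theory.
Import numFieldNormedType.Exports.

Local Open Scope classical_set_scope.
Local Open Scope ring_scope.

(** In the exact proximal problem at [y], the objective at the proximal point of
    a perturbed gradient exceeds the infimum by at most [|delta|^2 / (2 L)],
    where [delta] is the gradient error.  Hence the decrease
    [rho |c(y)| - inf] of the exact problem at [y_j] is at most
    [Phi(y_j) - Phi(y_{j+1}) + |delta_j|^2 / (2 L)], with no term linear in
    [delta_j], so the expectation at the random index only needs telescoping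
    and [E |delta_j|^2 <= sigma^2 / m].

    This decrease, times [2 L], bounds [|grad f + J^T lambda|^2] for the least
    squares multiplier [lambda] (test the step [- (grad f + J^T lambda) / L]).
    It also controls [theta] (test the steps [t s] with [|s| <= 1]), and no
    steering condition at [x_N] is needed since
    [rho theta <= |grad f| + phi_rho]. *)

(** * Euclidean norms *)

Section EuclideanTheory.
Context {R : realType}.

(** The penalty parameter and the number of oracle calls are random, hence so are the batch size and
    the iteration count; all are known when a call starts. Averages over the random index are
    therefore taken on events of [past] where batch size and iteration count are constant, then
    summed over their countably many values.

    The budget is split as follows. Telescoping and variance cost [eps / 4] each, so [2 L] times the
    decrease has expectation at most [eps / 2]. The other [eps / 2] pays for measurability of the
    multiplier: the least squares solution is obtained pointwise, outcome by outcome, and is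
    replaced by a measurable choice among rational vectors. *)

Lemma dotC n (u v : 'rV[R]_n) : dot u v = dot v u.
Proof. by apply: eq_bigr => i _; rewrite mulrC. Qed.

Lemma dotDl n (u v w : 'rV[R]_n) : dot (u + v) w = dot u w + dot v w.
Proof. by rewrite -big_split; apply: eq_bigr => i _; rewrite !mxE mulrDl. Qed.

Lemma dotZl n a (u w : 'rV[R]_n) : dot (a *: u) w = a * dot u w.
Proof. by rewrite mulr_sumr; apply: eq_bigr => i _; rewrite !mxE mulrA. Qed.

Lemma dotDr n (u v w : 'rV[R]_n) : dot w (u + v) = dot w u + dot w v.
Proof. by rewrite dotC dotDl !(dotC w). Qed.

Lemma dotZr n a (u w : 'rV[R]_n) : dot w (a *: u) = a * dot w u.
Proof. by rewrite dotC dotZl (dotC w). Qed.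

Lemma dotNl n (u w : 'rV[R]_n) : dot (- u) w = - dot u w.
Proof. by rewrite -scaleN1r dotZl mulN1r. Qed.

Lemma dotNr n (u w : 'rV[R]_n) : dot w (- u) = - dot w u.
Proof. by rewrite dotC dotNl dotC. Qed.

Lemma dot0l n (w : 'rV[R]_n) : dot 0 w = 0.
Proof. by rewrite -(scale0r 0) dotZl mul0r. Qed.

Lemma dot_ge0 n (u : 'rV[R]_n) : 0 <= dot u u.
Proof. by apply: sumr_ge0 => i _; rewrite -expr2 sqr_ge0. Qed.

Lemma dot_eq0 n (u : 'rV[R]_n) : dot u u = 0 -> u = 0.
Proof.
move=> /eqP; rewrite psumr_eq0; last by move=> i _; rewrite -expr2 sqr_ge0.
move=> /allP u0; apply/rowP => i; rewrite mxE; apply/eqP.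
by have := u0 i (mem_index_enum _); rewrite /= mulf_eq0 orbb.
Qed.

Lemma dot_mulmx n q (u : 'rV[R]_n) (v : 'rV[R]_q) (A : 'M[R]_(n, q)) :
  dot (u *m A) v = dot u (v *m A^T).
Proof.
have dotE m (a b : 'rV[R]_m) : dot a b = (a *m b^T) ord0 ord0.
  by rewrite mxE; apply: eq_bigr => i _; rewrite !mxE.
by rewrite !dotE trmx_mul trmxK mulmxA.
Qed.

Lemma enorm_ge0 n (u : 'rV[R]_n) : 0 <= enorm u.
Proof. exact: sqrtr_ge0. Qed.

Lemma sqr_enorm n (u : 'rV[R]_n) : enorm u ^+ 2 = dot u u.
Proof. by rewrite sqr_sqrtr ?dot_ge0. Qed.

Lemma enorm0 n : enorm (0 : 'rV[R]_n) = 0.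
Proof. by rewrite /enorm dot0l sqrtr0. Qed.

Lemma enorm_eq0 n (u : 'rV[R]_n) : enorm u = 0 -> u = 0.
Proof. by move=> u0; apply: dot_eq0; rewrite -sqr_enorm u0 expr0n. Qed.

Lemma enormZ n a (u : 'rV[R]_n) : enorm (a *: u) = `|a| * enorm u.
Proof. by rewrite /enorm dotZl dotZr mulrA -expr2 sqrtrM ?sqr_ge0// sqrtr_sqr. Qed.

Lemma enormN n (u : 'rV[R]_n) : enorm (- u) = enorm u.
Proof. by rewrite -scaleN1r enormZ normrN1 mul1r. Qed.

Lemma sqr_enormD n (u v : 'rV[R]_n) :
  enorm (u + v) ^+ 2 = enorm u ^+ 2 + 2 * dot u v + enorm v ^+ 2.
Proof. by rewrite !sqr_enorm dotDl !dotDr (dotC v u); ring. Qed.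

Lemma dot_le_enorm n (u v : 'rV[R]_n) : dot u v <= enorm u * enorm v.
Proof.
have [v0|v0] := eqVneq (enorm v) 0.
  by rewrite (enorm_eq0 v0) dotC dot0l enorm0 mulr0.
have [u0|u0] := eqVneq (enorm u) 0.
  by rewrite (enorm_eq0 u0) dot0l enorm0 mul0r.
have up : 0 < enorm u by rewrite lt_neqAle eq_sym u0 enorm_ge0.
have vp : 0 < enorm v by rewrite lt_neqAle eq_sym v0 enorm_ge0.
(* This square equals [2 |u| |v| (|u| |v| - u . v)]. *)
have := sqr_ge0 (enorm (enorm v *: u - enorm u *: v)).
rewrite sqr_enormD enormN !enormZ dotNr dotZl dotZr !ger0_norm ?enorm_ge0//.
have uvp : 0 < enorm u * enorm v by rewrite mulr_gt0.
move=> h; rewrite -(ler_pM2l uvp); nra.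
Qed.

Lemma ler_enormD n (u v : 'rV[R]_n) : enorm (u + v) <= enorm u + enorm v.
Proof.
rewrite -(@ler_pXn2r _ 2)// ?nnegrE ?addr_ge0 ?enorm_ge0//.
have := dot_le_enorm u v; rewrite sqr_enormD sqrrD; lra.
Qed.

Lemma enorm_coord n (u : 'rV[R]_n) i : `|u ord0 i| <= enorm u.
Proof.
rewrite -sqrtr_sqr ler_sqrt ?dot_ge0// /dot (bigD1 i)//= expr2 lerDl.
by apply: sumr_ge0 => j _; rewrite -expr2 sqr_ge0.
Qed.

Lemma enorm_le_sum n (u : 'rV[R]_n) : enorm u <= \sum_i `|u ord0 i|.
Proof.
have s0 : 0 <= \sum_i `|u ord0 i| by apply: sumr_ge0.
rewrite -(@ler_pXn2r _ 2)// ?nnegrE ?enorm_ge0// sqr_enorm expr2 mulr_suml.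
apply: ler_sum => i _; rewrite (le_trans (ler_norm _))// normrM.
by rewrite ler_wpM2l// (bigD1 i)//= lerDl sumr_ge0.
Qed.

(** Without boundedness [sup] would be a default value; this is what gives [opnorm] its meaning. *)
Lemma has_sup_opnorm n q (A : 'M[R]_(n, q)) :
  has_sup [set enorm (s *m A) | s in [set s : 'rV[R]_n | enorm s <= 1]].
Proof.
split; first by exists (enorm (0 *m A)), 0 => //=; rewrite enorm0.
exists (\sum_j \sum_i `|A i j|) => _ [s /= s1 <-].
rewrite (le_trans (enorm_le_sum _))//; apply: ler_sum => j _.
rewrite mxE (le_trans (ler_norm_sum _ _ _))//; apply: ler_sum => i _.
by rewrite normrM ler_piMl// (le_trans (enorm_coord _ _)).
Qed.

Lemma enorm_mulmx n q (s : 'rV[R]_n) (A : 'M[R]_(n, q)) :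
  enorm (s *m A) <= opnorm A * enorm s.
Proof.
have [s0|s0] := eqVneq (enorm s) 0.
  by rewrite (enorm_eq0 s0) mul0mx !enorm0 mulr0.
have sp : 0 < enorm s by rewrite lt_neqAle eq_sym s0 enorm_ge0.
rewrite -ler_pdivrMr//; apply: ub_le_sup; first exact: (has_sup_opnorm A).2.
exists ((enorm s)^-1 *: s) => /=.
  by rewrite enormZ ger0_norm ?invr_ge0 ?enorm_ge0// mulVf.
by rewrite -scalemxAl enormZ ger0_norm ?invr_ge0 ?enorm_ge0// mulrC.
Qed.

Lemma opnorm_ge0 n q (A : 'M[R]_(n, q)) : 0 <= opnorm A.
Proof.
apply: ub_le_sup; first exact: (has_sup_opnorm A).2.
by exists 0 => /=; rewrite ?mul0mx enorm0.
Qed.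

(** Reduces a bound on a vector to bounds on its pairings with unit vectors, for use in
    [descent_c]. *)
Lemma enorm_le_dot n (r : 'rV[R]_n) (a : R) : 0 <= a ->
  (forall v, enorm v <= 1 -> dot r v <= a) -> enorm r <= a.
Proof.
move=> a0 h; have [->//|r0] := eqVneq (enorm r) 0.
have rp : 0 < enorm r by rewrite lt_neqAle eq_sym r0 enorm_ge0.
have := h ((enorm r)^-1 *: r); rewrite enormZ ger0_norm ?invr_ge0 ?enorm_ge0//.
by rewrite mulVf// dotZr -sqr_enorm expr2 mulKf// => /(_ (lexx _)).
Qed.

(* The normal equations are solvable because [A^T A] and [A] have the same row
   space. *)
Lemma least_squares n q (g : 'rV[R]_n) (A : 'M[R]_(n, q)) :
  exists l : 'rV[R]_q, (g + l *m A^T) *m A = 0.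
Proof.
have k : (kermx (A^T *m A) <= kermx A^T)%MS.
  apply/sub_kermxP/row_matrixP => i; rewrite row_mul row0; apply: dot_eq0.
  by rewrite dot_mulmx trmxK -mulmxA -row_mul mulmx_ker row0 dotC dot0l.
have AA : (A <= A^T *m A)%MS.
  rewrite -(geq_leqif (mxrank_leqif_sup (submxMl A^T A))) -mxrank_tr.
  by rewrite -(leq_sub2lE _ (rank_leq_row A^T)) -!mxrank_ker mxrankS.
have /submxP[D hD] : (g *m A <= A^T *m A)%MS by rewrite (submx_trans (submxMl _ _)).
by exists (- D); rewrite mulmxDl hD !mulNmx mulmxA subrr.
Qed.

End EuclideanTheory.

(** * Descent of a proximal step *)

Section Smoothness.
Context {R : realType}.

(** Pairing with a fixed [v], as a function of the other argument, so that it carries the structure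
    of a linear map and can be differentiated. *)
Definition dotr n (v u : 'rV[R]_n) : R := dot u v.

Fact dotr_is_linear n (v : 'rV[R]_n) : linear (dotr v).
Proof. by move=> a x y; rewrite /dotr dotDl dotZl. Qed.

HB.instance Definition _ n (v : 'rV[R]_n) :=
  GRing.isLinear.Build R 'rV[R]_n R _ (dotr v) (dotr_is_linear v).

Lemma dotr_continuous n (v : 'rV[R]_n) : continuous (dotr v).
Proof.
apply: continuous_big => [|i _ u]; first exact: add_continuous.
exact: (cvgM (@coord_continuous _ _ _ ord0 i u) (cvg_cst _)).
Qed.

Lemma is_derive_line n (f : 'rV[R]_n -> R) x d t : differentiable f (x + t *: d) ->
  is_derive t 1 (fun t : R => f (x + t *: d)) ('d f (x + t *: d) d).
Proof.
move=> df; have dd : derivable f (x + t *: d) d by exact: diff_derivable.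
rewrite -(deriveE _ df); move: dd.
have e : (fun h : R => h^-1 *: (f (x + (h *: 1 + t) *: d) - f (x + t *: d)))
   = (fun h => h^-1 *: (f (h *: d + (x + t *: d)) - f (x + t *: d))).
  by apply/funext => h; rewrite scalerDl addrCA [h *: 1]mulr1.
by rewrite /derive /derivable => dd; split; rewrite /derivable /derive /= e.
Qed.

Lemma diff_grad n (f : 'rV[R]_n -> R) x d : differentiable f x ->
  'd f x d = dot (grad f x) d.
Proof.
move=> df; rewrite [in LHS](row_sum_delta d) linear_sum.
by apply: eq_bigr => i _; rewrite linearZ/= mxE deriveE// mulrC.
Qed.

Lemma diff_dot n q (c : 'rV[R]_n -> 'rV[R]_q) v x d : differentiable c x ->
  differentiable (dotr v \o c) x /\ 'd (dotr v \o c) x d = dot (d *m 'J c x) v.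
Proof.
move=> dc; have dv : differentiable (dotr v) (c x).
  exact/linear_differentiable/dotr_continuous.
split; first exact: differentiable_comp.
rewrite diff_comp//= diff_lin; last exact: dotr_continuous.
by rewrite /dotr -deriveEjacobian// deriveE.
Qed.

(** The difference [p] between [h] and its quadratic model has a nonpositive derivative on [[0, 1]],
    so [p 1 <= p 0]. This monotonicity argument replaces the integral form of Taylor's formula. *)
Lemma quadratic_upper_bound (h h' : R -> R) (M : R) :
  (forall t : R, is_derive t 1 h (h' t)) ->
  (forall t, 0 <= t -> h' t - h' 0 <= M * t) ->
  h 1 <= h 0 + h' 0 + M / 2.
Proof.
move=> dh le_h'.
pose p t := h t - h' 0 * t - M / 2 * t ^+ 2.
have dp (t : R) : is_derive t 1 p (h' t - h' 0 - M * t).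
  rewrite /p; apply: is_derive_eq.
  by rewrite /GRing.scale/= ?expr1; field.
have := @ler0_derive1_le_cc _ p 0 1 _ _ _ 1 0.
rewrite !in_itv/= !lexx !ler01 /p => /(_ _ _ _ isT isT isT).
have -> : h 0 - h' 0 * 0 - M / 2 * 0 ^+ 2 = h 0 by ring.
rewrite mulr1 expr1n mulr1 => H; suff : h 1 - h' 0 - M / 2 <= h 0 by lra.
apply: H.
- by move=> t _; have [] := dp t.
- move=> t; rewrite in_itv/= => /andP[t0 _]; rewrite derive1E.
  have [_ ->] := dp t; have := le_h' t (ltW t0); lra.
- apply: continuous_subspaceT => t; apply/differentiable_continuous.
  by apply/derivable1_diffP; have [] := dp t.
Qed.

Lemma descent_f n q (f : 'rV[R]_n -> R) (c : 'rV[R]_n -> 'rV[R]_q) flow Lg LJ :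
  AS1 f c flow Lg LJ -> forall x d,
  f (x + d) <= f x + dot (grad f x) d + Lg / 2 * enorm d ^+ 2.
Proof.
move=> as1 x d.
have := @quadratic_upper_bound (fun t => f (x + t *: d))
  (fun t => dot (grad f (x + t *: d)) d) (Lg * enorm d ^+ 2).
rewrite scale1r scale0r addr0 mulrAC; apply => [t|t t0].
  rewrite -diff_grad; last exact: (AS1_df as1).
  exact/is_derive_line/(AS1_df as1).
rewrite -dotNl -dotDl (le_trans (dot_le_enorm _ _))//.
have -> : Lg * enorm d ^+ 2 * t = Lg * (t * enorm d) * enorm d by ring.
rewrite ler_wpM2r ?enorm_ge0// (le_trans (AS1_Lg as1 _ _))//.
by rewrite addrC addKr enormZ ger0_norm.
Qed.

(** Pairing [c] with a unit vector [v] leads back to the scalar case. Working with all [v], not with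
    the coordinates of [c], keeps the constant [LJ] free of a factor depending on [q]. *)
Lemma descent_c n q (f : 'rV[R]_n -> R) (c : 'rV[R]_n -> 'rV[R]_q) flow Lg LJ :
  AS1 f c flow Lg LJ -> 0 <= LJ -> forall x d,
  enorm (c (x + d) - (c x + d *m 'J c x)) <= LJ / 2 * enorm d ^+ 2.
Proof.
move=> as1 LJ0 x d; apply: enorm_le_dot => [|v v1].
  by rewrite mulr_ge0 ?divr_ge0 ?sqr_ge0.
have dd y := diff_dot v d (AS1_dc as1 y).
have := @quadratic_upper_bound (fun t => (dotr v \o c) (x + t *: d))
  (fun t => dot (d *m 'J c (x + t *: d)) v) (LJ * enorm d ^+ 2).
rewrite scale1r scale0r addr0 /comp /dotr => H.
rewrite dotDl dotNl dotDl.
suff : dot (c (x + d)) v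
    <= dot (c x) v + dot (d *m 'J c x) v + LJ * enorm d ^+ 2 / 2 by lra.
apply: H => [t|t t0].
  rewrite -(dd _).2; exact/(@is_derive_line _ (dotr v \o c))/(dd _).1.
rewrite -dotNl -dotDl -mulmxBr.
rewrite (le_trans (dot_le_enorm _ _))// (le_trans (ler_piMr _ v1)) ?enorm_ge0//.
rewrite (le_trans (enorm_mulmx _ _))//.
have -> : LJ * enorm d ^+ 2 * t = LJ * (t * enorm d) * enorm d by ring.
rewrite ler_wpM2r ?enorm_ge0// (le_trans (AS1_LJ as1 _ _))//.
by rewrite addrC addKr enormZ ger0_norm.
Qed.

End Smoothness.

(** * Strong convexity of the proximal problem and consequences of a small decrease *)

Section ProximalStep.
Context {R : realType} (n q : nat).
Variables (f : 'rV[R]_n -> R) (c : 'rV[R]_n -> 'rV[R]_q) (flow Lg LJ : R).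
Hypotheses (Lg0 : 0 < Lg) (LJ0 : 0 < LJ) (as1 : AS1 f c flow Lg LJ).

(** The linear term and the norm of the linearized constraint are convex; the quadratic term
    satisfies the inequality with equality and supplies all the strong convexity. *)
Lemma prox_obj_strongly_convex rho gamma x g u v t :
  0 <= rho -> 0 < gamma -> 0 <= t <= 1 ->
  prox_obj c rho gamma x g (u + t *: (v - u))
    <= (1 - t) * prox_obj c rho gamma x g u + t * prox_obj c rho gamma x g v
       - (2 * gamma)^-1 * (t * (1 - t) * enorm (v - u) ^+ 2).
Proof.
move=> rho0 gam0 /andP[t0 t1]; rewrite /prox_obj.
have -> : u + t *: (v - u) - x = (1 - t) *: (u - x) + t *: (v - x).
  by apply/rowP => i; rewrite !mxE; ring.
have -> : v - u = (v - x) - (u - x) by apply/rowP => i; rewrite !mxE; ring.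
move: (u - x) (v - x) => a b.
have -> : c x + ((1 - t) *: a + t *: b) *m 'J c x
    = (1 - t) *: (c x + a *m 'J c x) + t *: (c x + b *m 'J c x).
  rewrite mulmxDl -!scalemxAl.
  by apply/rowP => i; rewrite !mxE; ring.
have := ler_enormD ((1 - t) *: (c x + a *m 'J c x)) (t *: (c x + b *m 'J c x)).
rewrite !enormZ !ger0_norm ?subr_ge0// => /(ler_wpM2l rho0).
set X := enorm (_ + _); set A := enorm (_ + _); set B := enorm (_ + _) => hX.
rewrite !sqr_enormD enormN !enormZ dotDr !dotZr dotZl dotNr (dotC b a).
rewrite !ger0_norm ?subr_ge0//.
set k := (2 * gamma)^-1; nra.
Qed.

Lemma prox_obj_argmin rho gamma x g u v :
  0 <= rho -> 0 < gamma -> is_argmin (prox_obj c rho gamma x g) u ->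
  prox_obj c rho gamma x g u + (2 * gamma)^-1 * enorm (v - u) ^+ 2
    <= prox_obj c rho gamma x g v.
Proof.
move=> rho0 gam0 umin; apply/ler_addgt0Pr => e e0.
set K := (2 * gamma)^-1 * enorm (v - u) ^+ 2.
have K0 : 0 <= K by rewrite mulr_ge0 ?sqr_ge0// invr_ge0 mulr_ge0 ?ltW.
(* Strong convexity at this [t] gives, after division by [t], the claim up to an error [t * K], and
   this [t] makes [t * K <= e]. The summand [e] keeps the denominator positive when [K = 0]. *)
pose t := e / (e + K); have eK : 0 < e + K by lra.
have t0 : 0 < t by rewrite divr_gt0.
have t1 : t <= 1 by rewrite ler_pdivrMr// mul1r lerDl.
have tK : t * K <= e.
  by rewrite /t mulrAC ler_pdivrMr// ler_pM2l// lerDr ltW.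
have := prox_obj_strongly_convex x g u v rho0 gam0 (t := t).
rewrite t1 (ltW t0) => /(_ isT); have := umin (u + t *: (v - u)).
rewrite [_^-1 * (t * _ * _)]mulrCA -/K => h1.
move=> /(le_trans h1) h2.
have : t * (prox_obj c rho gamma x g u + (1 - t) * K)
  <= t * prox_obj c rho gamma x g v.
  by lra.
rewrite ler_pM2l// => h3; lra.
Qed.

Lemma prox_step_descent rho x g y u : 0 <= rho ->
  is_argmin (prox_obj c rho (1 / L_ Lg LJ rho) x g) y ->
  Phi f c rho y <= f x + prox_obj c rho (1 / L_ Lg LJ rho) x (grad f x) u
                  + enorm (g - grad f x) ^+ 2 / (2 * L_ Lg LJ rho).
Proof.
move=> rho0 ymin.
have L0 : 0 < L_ Lg LJ rho by rewrite /L_ ltr_wpDr// mulr_ge0// ltW.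
have gam0 : 0 < 1 / L_ Lg LJ rho by rewrite divr_gt0.
have := prox_obj_argmin u rho0 gam0 ymin.
have gamE : (2 * (1 / L_ Lg LJ rho))^-1 = L_ Lg LJ rho / 2.
  by rewrite mul1r invfM invrK mulrC.
rewrite /prox_obj gamE.
have := descent_f as1 x (y - x).
have := descent_c as1 (ltW LJ0) x (y - x).
have := ler_enormD (c x + (y - x) *m 'J c x) (c y - (c x + (y - x) *m 'J c x)).
have -> : x + (y - x) = y by rewrite addrC subrK.
rewrite addrCA subrr addr0 => h1 /(le_trans _) h2 h3 h4.
have h5 : rho * enorm (c y) <= rho * enorm (c x + (y - x) *m 'J c x)
    + rho * (LJ / 2 * enorm (y - x) ^+ 2).
  rewrite -mulrDr ler_wpM2l// (le_trans h1)// lerD2l.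
  exact: h2 (lexx _).
set d := g - grad f x.
(* Completing the square: the strong convexity term [L / 2 |u - y|^2] absorbs the correlation of the
   gradient error with [u - y]. *)
have h6 : - (enorm d ^+ 2 / (2 * L_ Lg LJ rho)) <=
   L_ Lg LJ rho / 2 * enorm (u - y) ^+ 2 - dot d (u - y).
  have := dot_le_enorm d (u - y); set p := enorm d; set r := enorm (u - y).
  set L := L_ _ _ _ in L0 *; move=> hd.
  have : 0 <= (L * r - p) ^+ 2 / (2 * L).
    by rewrite divr_ge0 ?sqr_ge0// mulr_ge0// ltW.
  have -> : (L * r - p) ^+ 2 / (2 * L) = L / 2 * r ^+ 2 - p * r + p ^+ 2 / (2 * L).
    by field; rewrite gt_eqF.
  lra.
have h7 : dot d (u - y) = dot g (u - x) - dot g (y - x)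
    - (dot (grad f x) (u - x) - dot (grad f x) (y - x)).
  have -> : u - y = (u - x) - (y - x) by apply/rowP => i; rewrite !mxE; ring.
  by rewrite /d !dotDl !dotDr !dotNr !dotNl !dotDr !dotNr; ring.
(* The stepsize [1 / L] is chosen for this identity: the proximal term equals the sum of the model
   errors of [f] and of [rho |c|]. *)
have h8 : Lg / 2 * enorm (y - x) ^+ 2 + rho * (LJ / 2 * enorm (y - x) ^+ 2)
   = L_ Lg LJ rho / 2 * enorm (y - x) ^+ 2 by rewrite /L_; ring.
rewrite /Phi; lra.
Qed.

(** A bound on the decrease achievable by the exact proximal problem, with a quantifier in place of
    the infimum: each test point [u] then gives a consequence by instantiation. *)
Definition prox_decrease_le rho x U := forall u,
  rho * enorm (c x) - prox_obj c rho (1 / L_ Lg LJ rho) x (grad f x) u <= U.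

Lemma prox_decrease_dual rho x U : 0 <= rho -> prox_decrease_le rho x U ->
  exists l : 'rV[R]_q,
    enorm (grad f x + l *m ('J c x)^T) ^+ 2 <= 2 * L_ Lg LJ rho * U.
Proof.
move=> rho0 hU.
have L0 : 0 < L_ Lg LJ rho by rewrite /L_ ltr_wpDr// mulr_ge0// ltW.
have [l hl] := least_squares (grad f x) ('J c x); exists l.
set p := grad f x + _ in hl *.
have := hU (x - (L_ Lg LJ rho)^-1 *: p); rewrite /prox_obj.
have -> : x - (L_ Lg LJ rho)^-1 *: p - x = - ((L_ Lg LJ rho)^-1 *: p).
  by rewrite addrC addKr.
(* By the normal equations the test step leaves the linearized constraint at [c x]. They also make
   [p] orthogonal to [J^T l], so that the linear term is a multiple of [|p|^2]. *)
rewrite mulNmx -scalemxAl hl scaler0 subr0 dotNr dotZr enormN enormZ.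
have -> : dot (grad f x) p = enorm p ^+ 2.
  have lp : dot (l *m ('J c x)^T) p = 0 by rewrite dot_mulmx trmxK hl dotC dot0l.
  by rewrite sqr_enorm -[in LHS](addrK (l *m ('J c x)^T) (grad f x)) -/p dotDl dotNl lp subr0.
rewrite exprMn real_normK ?num_real// mul1r.
set L := L_ _ _ _ in L0 *; set P := enorm p ^+ 2; set C := rho * _.
have -> : C - (- (L^-1 * P) + C + (2 / L)^-1 * (L^-1 ^+ 2 * P)) = P / (2 * L).
  by field; rewrite gt_eqF.
by rewrite ler_pdivrMr ?mulr_gt0// mulrC.
Qed.

Lemma prox_decrease_theta rho x U kg kJ Cb (h := Num.sqrt (2 * L_ Lg LJ rho * U)) :
  0 <= rho -> prox_decrease_le rho x U -> 0 <= kg -> 0 <= kJ ->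
  enorm (grad f x) <= kg -> opnorm ('J c x) <= kJ ->
  kJ / LJ + kg / Lg <= Cb ->
  rho * theta c x
    <= kg + 2 * Cb * h + Num.sqrt (2 * Cb * h * L_ Lg LJ rho).
Proof.
move=> rho0 hU kg0 kJ0 hg hJ hCb.
have L0 : 0 < L_ Lg LJ rho by rewrite /L_ ltr_wpDr// mulr_ge0// ltW.
have Cb0 : 0 <= Cb by rewrite (le_trans _ hCb)// addr_ge0 ?divr_ge0// ltW.
have U0 : 0 <= U.
  have := hU x; rewrite /prox_obj subrr mul0mx addr0 dotC dot0l enorm0.
  by rewrite expr0n mulr0 addr0 add0r subrr.
have h0 : 0 <= h by exact: sqrtr_ge0.
have h2 : h ^+ 2 = 2 * L_ Lg LJ rho * U.
  by rewrite sqr_sqrtr// !mulr_ge0// ltW.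
(* The second term bounds the decrease a priori; the geometric mean of the two
   is what produces the factor [Cb] in front of [h]. *)
pose V := Num.min U (L_ Lg LJ rho * Cb ^+ 2 / 2).
(* Origin of [Cb]: as [L_] dominates both [Lg] and [rho * LJ], its product with [kJ / LJ + kg / Lg]
   dominates the slope [kg + rho * kJ] of the linear model. *)
have gJ : kg + rho * kJ <= L_ Lg LJ rho * Cb.
  rewrite (@le_trans _ _ (L_ Lg LJ rho * (kJ / LJ + kg / Lg)))//; last first.
    by rewrite ler_wpM2l// ltW.
  have -> : L_ Lg LJ rho * (kJ / LJ + kg / Lg)
      = kg + rho * kJ + (Lg * kJ / LJ + rho * LJ * kg / Lg).
    by rewrite /L_; field; rewrite !gt_eqF.
  by rewrite lerDl addr_ge0// divr_ge0 ?mulr_ge0// ltW.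
(* With [D = |u - x|], the slope bound [gJ] limits the decrease to [L (Cb D - D^2 / 2)], which is
   largest at [D = Cb]. *)
have hV u : rho * enorm (c x)
    - prox_obj c rho (1 / L_ Lg LJ rho) x (grad f x) u <= V.
  rewrite le_min hU/= /prox_obj mul1r invfM invrK; set d := u - x.
  have dJ : enorm (c x) <= enorm (c x + d *m 'J c x) + kJ * enorm d.
    have := ler_enormD (c x + d *m 'J c x) (- (d *m 'J c x)).
    rewrite addrK enormN => /le_trans; apply; rewrite lerD2l.
    by rewrite (le_trans (enorm_mulmx _ _))// ler_wpM2r ?enorm_ge0.
  have := dot_le_enorm (- grad f x) d; rewrite dotNl enormN => gd.
  have gd' : enorm (grad f x) * enorm d <= kg * enorm d.
    by rewrite ler_wpM2r ?enorm_ge0.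
  have := ler_wpM2l rho0 dJ; have := ler_wpM2r (enorm_ge0 d) gJ.
  have : 0 <= L_ Lg LJ rho * (Cb - enorm d) ^+ 2.
    by rewrite mulr_ge0 ?sqr_ge0// ltW.
  move: gd gd'; set L := L_ _ _ _; set D := enorm d; set A := enorm (c x); set B := enorm (_ + _).
  lra.
have VU : V <= U by rewrite ge_min lexx.
have VC : V <= L_ Lg LJ rho * Cb ^+ 2 / 2 by rewrite ge_min lexx orbT.
have V0 : 0 <= V by rewrite le_min U0 divr_ge0// mulr_ge0 ?sqr_ge0// ltW.
have Vh : V <= Cb * h / 2.
  rewrite -(@ler_pXn2r _ 2)// ?nnegrE ?divr_ge0 ?mulr_ge0//.
  have -> : (Cb * h / 2) ^+ 2 = U * (L_ Lg LJ rho * Cb ^+ 2 / 2).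
    by rewrite !exprMn h2; field.
  by rewrite expr2 ler_pM.
set B := 2 * Cb * h + Num.sqrt (2 * Cb * h * L_ Lg LJ rho).
have B0 : 0 <= B by rewrite addr_ge0 ?sqrtr_ge0// !mulr_ge0.
have main s : enorm s <= 1 ->
   rho * enorm (c x) - rho * enorm (c x + s *m 'J c x) <= kg + B.
  move=> s1.
  set a := rho * enorm (c x) - rho * enorm (c x + s *m 'J c x) - dot (grad f x) s.
  suff aB : a <= B.
    have := dot_le_enorm (grad f x) s.
    have : enorm (grad f x) * enorm s <= kg by rewrite (le_trans _ hg)// ler_piMr ?enorm_ge0.
    by rewrite /a in aB *; lra.
  (* By convexity of the norm, the step [t s] gains at least the fraction [t] of the linear gain [a]
     of the full step [s], while its quadratic cost scales like [t ^+ 2]. *)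
  have ta t : 0 <= t <= 1 -> t * a - L_ Lg LJ rho / 2 * t ^+ 2 <= V.
    move=> /andP[t0 t1]; have := hV (x + t *: s); rewrite /prox_obj.
    have -> : x + t *: s - x = t *: s by rewrite addrC addKr.
    move=> H.
    have e : c x + t *: s *m 'J c x
        = (1 - t) *: c x + t *: (c x + s *m 'J c x).
      by rewrite -scalemxAl; apply/rowP => i; rewrite !mxE; ring.
    have := ler_enormD ((1 - t) *: c x) (t *: (c x + s *m 'J c x)).
    rewrite -e !enormZ !ger0_norm ?subr_ge0// => /(ler_wpM2l rho0).
    have : L_ Lg LJ rho / 2 * (t * enorm s) ^+ 2 <= L_ Lg LJ rho / 2 * t ^+ 2.
      apply: ler_wpM2l; first by rewrite divr_ge0// ltW.
      by rewrite exprMn ler_piMr ?sqr_ge0// exprn_ile1 ?enorm_ge0.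
    move: H; rewrite dotZr enormZ ger0_norm// mul1r invfM invrK [2^-1 * _]mulrC.
    rewrite /a; lra.
  have [a0|a0] := leP a 0; first exact: le_trans B0.
  (* The best [t] is the minimum of [1] and [a / L]. If [a <= L] then [a ^+ 2 <= 2 * L * V], whence
     the square root term; otherwise [t = 1] gives [a <= 2 * V], whence the term linear in [h]. *)
  have [aL|aL] := leP a (L_ Lg LJ rho).
    have := ta (a / L_ Lg LJ rho).
    rewrite divr_ge0 ?(ltW a0) ?(ltW L0)// ler_pdivrMr// mul1r => /(_ aL).
    have -> : a / L_ Lg LJ rho * a - L_ Lg LJ rho / 2 * (a / L_ Lg LJ rho) ^+ 2
        = a ^+ 2 / (2 * L_ Lg LJ rho) by field; rewrite gt_eqF.
    rewrite ler_pdivrMr ?mulr_gt0// => a2.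
    apply: ler_wpDl; first by rewrite !mulr_ge0.
    rewrite -[leLHS](ger0_norm (ltW a0)) -sqrtr_sqr ler_sqrt; last first.
      by rewrite !mulr_ge0// ltW.
    apply: (le_trans a2).
    have := ler_wpM2r (ltW L0) Vh; have : 0 <= Cb * h * L_ Lg LJ rho.
      by rewrite !mulr_ge0// ltW.
    lra.
  have := ta 1; rewrite ler01 lexx => /(_ isT); rewrite expr1n !mul1r mulr1 => a1.
  have : 0 <= Cb * h by rewrite mulr_ge0.
  by rewrite /B; have := sqrtr_ge0 (2 * Cb * h * L_ Lg LJ rho); lra.
rewrite -addrA -/B /theta mulrBr lerBlDr -lerBlDl.
set S := [set _ | _ in _].
have [->|rp] := eqVneq rho 0; first by rewrite !mul0r sub0r oppr_le0 addr_ge0.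
have {}rp : 0 < rho by rewrite lt_neqAle eq_sym rp.
rewrite [leRHS]mulrC -ler_pdivrMr//; apply: lb_le_inf.
  by exists (enorm (c x + 0 *m 'J c x)), 0 => //=; rewrite enorm0.
move=> _ [s /= s1 <-]; rewrite ler_pdivrMr// [leRHS]mulrC; have := main _ s1; lra.
Qed.

End ProximalStep.

(** * Conditional laws *)

Section KernelPreimage.
Local Open Scope ereal_scope.
Context d1 d2 d3 (X : measurableType d1) (Y : measurableType d2)
  (Z : measurableType d3) (R : realType).
Variables (k : R.-pker Y ~> Z) (g : X -> Y).

(** The kernel [k] pulled back along [g]. The measurability proof is an argument so that the kernel
    instances below can refer to it. *)
Definition kpreimage (mg : measurable_fun [set: X] g) (x : X) :
  {measure set Z -> \bar R} := k (g x).

Hypothesis mg : measurable_fun [set: X] g.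

Let measurable_kpreimage U : measurable U ->
  measurable_fun [set: X] (kpreimage mg ^~ U).
Proof.
move=> mU; have mk := measurable_kernel k U mU.
exact: (measurableT_comp mk mg).
Qed.

HB.instance Definition _ := isKernel.Build _ _ _ _ _ (kpreimage mg)
  measurable_kpreimage.

Let kpreimage_prob x : kpreimage mg x [set: Z] = 1.
Proof. exact: prob_kernel. Qed.

HB.instance Definition _ := Kernel_isProbability.Build _ _ _ _ _
  (kpreimage mg) kpreimage_prob.

End KernelPreimage.

Section SubSigmaAlgebra.
Local Open Scope ereal_scope.
Context d (Omega : measurableType d) (R : realType) (P : probability Omega R).
Variable (G : set_system Omega).
Hypothesis GM : G `<=` @measurable _ Omega.

Lemma sub_sigma_algebra_measurable : <<s G >> `<=` @measurable _ Omega.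
Proof. exact: (smallest_sub (@sigma_algebra_measurable _ Omega) GM). Qed.

(** The identity, seen as a random variable with values in the coarser measurable space, turns
    forgetting information into a pushforward. *)
Lemma measurable_id_sub :
  measurable_fun [set: Omega] (id : Omega -> g_sigma_algebraType G).
Proof. by move=> _ A mA; rewrite setTI; exact: sub_sigma_algebra_measurable. Qed.

Lemma measurable_fun_sub d' (T : measurableType d')
    (X : g_sigma_algebraType G -> T) :
  measurable_fun setT X -> measurable_fun setT (X : Omega -> T).
Proof. by move=> mX; exact: (measurableT_comp mX measurable_id_sub). Qed.

(* If [kappa (Y w)] is the conditional law of [zeta] given the sigma-algebra
   generated by [G], then the pair of the outcome and [zeta] has the law
   [P (dw) kappa (Y w, dz)]. *)
Context d1 d2 (E : measurableType d1) (Xi : measurableType d2).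
Variables (kappa : R.-pker E ~> Xi) (Y : g_sigma_algebraType G -> E)
  (zeta : Omega -> Xi).
Hypotheses (mY : measurable_fun setT Y) (mzeta : measurable_fun setT zeta).
Hypothesis law : forall A B, <<s G >> A -> measurable B ->
  P (A `&` zeta @^-1` B) = \int[P]_(w in A) kappa (Y w) B.

Lemma integral_conditional_law (h : g_sigma_algebraType G * Xi -> \bar R) :
  (forall p, 0 <= h p) -> measurable_fun setT h ->
  \int[P]_w h (w, zeta w) = \int[P]_w \int[kappa (Y w)]_z h (w, z).
Proof.
move=> h0 mh.
pose T1 := g_sigma_algebraType G.
pose pr w : T1 * Xi := (w : T1, zeta w).
have mpr : measurable_fun [set: Omega] pr.
  by apply: measurable_fun_pair => //; exact: measurable_id_sub.
pose ms := measurableT_comp measurable_id_sub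
  (@measurable_snd _ _ unit Omega).
pose l0 := kprobability (@measurable_cst _ _ unit _ setT (P : pprobability Omega R)).
pose l1 := kpreimage kappa (measurableT_comp mY ms).
pose pr' (p : unit * Omega * Xi) : T1 * Xi := (p.1.2 : T1, p.2).
have mpr' : measurable_fun setT pr'.
  apply: measurable_fun_pair; last exact: measurable_snd.
  exact: (measurableT_comp ms (@measurable_fst _ _ _ _)).
pose k1 := kdirac (R := R) mpr'.
(* [Q] is the measure [P (dw) kappa (Y w, dz)] on pairs. [P] is seen as a constant kernel on [unit],
   and the final Dirac kernel drops the [unit] component and moves [w] to the coarser
   sigma-algebra. *)
pose Q := mkcomp l0 (mkcomp l1 k1) tt.
have mX (A : set T1) (B : set Xi) : measurable A -> measurable B ->
    pushforward P pr (A `*` B) = Q (A `*` B).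
  move=> mA mB; rewrite -[LHS]/(P (A `&` zeta @^-1` B)) law//.
  rewrite -[RHS]/(\int[P]_w \int[kappa (Y w)]_z (\1_(A `*` B) (w : T1, z))%:E).
  rewrite integral_mkcond; apply: eq_integral => w _.
  rewrite patchE; case: ifPn => wA.
    rewrite -[B in LHS]setIT -integral_indic//; apply: eq_integral => z _.
    by rewrite !indicE in_setX/= wA.
  by symmetry; apply: integral0_eq => z _; rewrite indicE in_setX/= (negbTE wA).
transitivity (\int[pushforward P pr]_p h p).
  by rewrite ge0_integral_pushforward// => p _; exact: h0.
transitivity (\int[Q]_p h p).
  apply: eq_measure_integral => U mU _.
  (* Rectangles are stable under intersection and generate the product, and on them the two measures
     agree by [law]. *)
  pose C : set (set (T1 * Xi)) :=
    [set A `*` B | A in @measurable _ T1 & B in @measurable _ Xi].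
  apply: (measure_unique C (fun=> setT)) => //.
  - exact: measurable_prod_measurableType.
  - move=> _ _ [A mA [B mB <-]] [A' mA' [B' mB' <-]]; rewrite -setXI.
    by exists (A `&` A'); [exact: measurableI|exists (B `&` B') => //; exact: measurableI].
  - by move=> i; exists setT => //; exists setT => //; rewrite setXTT.
  - by rewrite bigcup_const.
  - by move=> _ [A mA [B mB <-]]; exact: mX.
  - by move=> k; rewrite -[X in X < _]/(P setT) probability_setT ltry.
rewrite /Q integral_kcomp//; apply: eq_integral => w _.
rewrite integral_kcomp//; apply: eq_integral => z _.
by rewrite integral_dirac// diracT mul1e.
Qed.

End SubSigmaAlgebra.

(** * Integrals of nonnegative functions: random indices, null sets, proportional measures *)

Section NonnegativeIntegrals.
Local Open Scope ereal_scope.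
Context d (Omega : measurableType d) (R : realType).

(** Besides random indices, this serves to freeze natural-valued parameters such as the batch size:
    measurability is then only to be checked at each fixed value. *)
Lemma measurable_fun_index d' (T : measurableType d') (M : Omega -> nat)
    (X : nat -> Omega -> T) :
  measurable_fun setT M -> (forall k, measurable_fun setT (X k)) ->
  measurable_fun setT (fun w => X (M w) w).
Proof.
move=> mM mX _ B mB; rewrite setTI.
have -> : (fun w => X (M w) w) @^-1` B
    = \bigcup_k (M @^-1` [set k] `&` X k @^-1` B).
  apply/seteqP; split=> [w Bw|w [k _ [/= <-]//]].
  by exists (M w).
apply: bigcupT_measurable => k; apply: measurableI.
  by rewrite -[X in measurable X]setTI; exact: mM.
by rewrite -[X in measurable X]setTI; exact: mX.
Qed.

Variable mu : {measure set Omega -> \bar R}.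

(** Lets a random natural number be treated as a constant, one level set at a time. *)
Lemma le_integral_index (M : Omega -> nat) (F H : Omega -> \bar R) :
  measurable_fun setT M -> measurable_fun setT F -> measurable_fun setT H ->
  (forall w, 0 <= F w) -> (forall w, 0 <= H w) ->
  (forall k, \int[mu]_(w in M @^-1` [set k]) F w
               <= \int[mu]_(w in M @^-1` [set k]) H w) ->
  \int[mu]_w F w <= \int[mu]_w H w.
Proof.
move=> mM mF mH F0 H0 le_FH.
have UM : setT = \bigcup_k (M @^-1` [set k]).
  by apply/seteqP; split=> // w _; exists (M w).
have mMk k : measurable (M @^-1` [set k]).
  by rewrite -[X in measurable X]setTI; exact: mM.
have tM : trivIset setT (fun k => M @^-1` [set k]).
  by move=> i j _ _ [w [/= <- <-]].
rewrite UM !ge0_integral_bigcup// -?UM//.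
by apply: lee_nneseries => [k _ _|k _]; [exact: integral_ge0|exact: le_FH].
Qed.

(** Applies to an [F] of unknown measurability, such as [theta] along the output: raising [H] to
    [+oo] on a null set makes the comparison hold everywhere, and the integral of a nonnegative
    function is a supremum over simple functions below it. *)
Lemma ae_le_integral (F H : Omega -> \bar R) :
  (forall w, 0 <= F w) -> (forall w, 0 <= H w) -> measurable_fun setT H ->
  {ae mu, forall w, F w <= H w} -> \int[mu]_w F w <= \int[mu]_w H w.
Proof.
move=> F0 H0 mH [N [mN N0 subN]].
pose H' w := if w \in N then +oo else H w.
have H'0 w : 0 <= H' w by rewrite /H'; case: ifP.
have mH' : measurable_fun setT H'.
  apply: measurable_fun_if => //.
  - apply: (measurable_fun_bool true).
    rewrite setTI (_ : _ @^-1` _ = N)//.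
    by apply/seteqP; split=> w /= => [/set_mem//|/mem_set].
  - exact: measurable_funS mH.
have FH' w : F w <= H' w.
  rewrite /H'; case: ifPn => [_|wN]; first exact: leey.
  apply: contrapT => FH; have := mem_set (subN _ FH).
  by rewrite (negbTE wN).
rewrite (_ : \int[mu]_w H w = \int[mu]_w H' w); last first.
  apply: ge0_ae_eq_integral => //; exists N; split => // w /= Hw.
  apply: contrapT => wN; apply: Hw => _; rewrite /H' ifF//.
  by apply/negbTE/negP => /set_mem.
rewrite ge0_integralTE// ge0_integralTE//; apply: le_ereal_sup => _ [h hF <-].
by exists h => // w; exact: le_trans (hF w) (FH' w).
Qed.

Variables (G : set_system Omega) (D D' : set Omega) (a : {nonneg R}).
Hypotheses (GM : G `<=` @measurable _ Omega) (mD : measurable D)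
  (mD' : measurable D').
Hypothesis muD : forall A, <<s G >> A ->
  mu (A `&` D) = a%:num%:E * mu (A `&` D').

(** Restricted to the sigma-algebra generated by [G], the traces of [mu] on [D] and [D'] are
    proportional measures, and [H] is measurable there. It is used with [D] the part of [D'] where
    the random index has a given value. *)
Lemma integral_proportional (H : g_sigma_algebraType G -> \bar R) :
  measurable_fun setT H -> (forall w, 0 <= H w) ->
  \int[mu]_(w in D) H w = a%:num%:E * \int[mu]_(w in D') H w.
Proof.
move=> mH H0.
have restr (B : set Omega) (mB : measurable B) :
    \int[mu]_(w in B) H w = \int[mrestr mu mB]_w H w.
  have mHB : measurable_fun setT (H : Omega -> \bar R).
    exact: measurable_fun_sub.
  rewrite [RHS](@ge0_negligible_integral _ _ _ _ _ (~` B))//.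
  - rewrite setTD setCK; apply: eq_measure_integral => A mA AB.
    by rewrite /= /mrestr setIidl.
  - exact: measurableC.
  - by rewrite /= /mrestr setICl measure0.
rewrite !restr.
have mid := measurable_id_sub GM.
have push (m : {measure set Omega -> \bar R}) :
    \int[m]_w H w
      = \int[pushforward m (id : Omega -> g_sigma_algebraType G)]_w H w.
  by symmetry; apply: ge0_integral_pushforward => // w _; exact: H0.
rewrite !push -ge0_integral_mscale//.
apply: eq_measure_integral => A mA _.
exact: (muD mA).
Qed.

End NonnegativeIntegrals.

(** * Variance of a batch of oracle answers *)

Section BorelRn.
Context {R : realType} (n : nat).

Lemma continuous_measurable_borelRn (F : 'rV[R]_n -> R) :
  continuous F -> measurable_fun setT (F : borelRn R n -> R).
Proof.
move=> cF; apply: (measurability _ (RGenOInfty.measurableE R)).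
move=> _ [_ [a ->] <-]; rewrite setTI; apply: sub_sigma_algebra.
by apply: open_comp => // x _; exact: cF.
Qed.

Lemma measurable_borelRn_coord d (T : measurableType d) (X : T -> borelRn R n) i :
  measurable_fun setT X ->
  measurable_fun setT (fun w => (X w : 'rV[R]_n) ord0 i).
Proof.
move=> mX; have mi := continuous_measurable_borelRn (@coord_continuous R 1 n ord0 i).
exact: (measurableT_comp mi mX).
Qed.

Lemma measurable_sqr_enorm m d (T : measurableType d) (X : T -> 'rV[R]_m) :
  (forall i, measurable_fun setT (fun w => X w ord0 i)) ->
  measurable_fun setT (fun w => enorm (X w) ^+ 2).
Proof.
move=> mX; under eq_fun do rewrite sqr_enorm.
by apply: measurable_sum => i; exact: measurable_funM.
Qed.

End BorelRn.

Section Oracle.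
Context {R : realType} (n : nat) (f : 'rV[R]_n -> R).
Context dX (Xi : measurableType dX) (o : oracle R n Xi) (sigma : R).
Hypothesis cf : continuous (grad f).

Lemma continuous_grad_coord i : continuous (fun x => grad f x ord0 i).
Proof.
move=> x.
exact: (cvg_comp _ _ (@cf x) (@coord_continuous R 1 n ord0 i (grad f x))).
Qed.

Definition oracle_error x z := oracle_grad o x z - grad f x.

Lemma measurable_oracle_error d (T : measurableType d) (Y : T -> borelRn R n)
    (Z : T -> Xi) i :
  measurable_fun setT Y -> measurable_fun setT Z ->
  measurable_fun setT (fun w => oracle_error (Y w) (Z w) ord0 i).
Proof.
move=> mY mZ; under eq_fun do rewrite !mxE.
apply: measurable_funB.
  apply: measurable_borelRn_coord.
  exact: (measurableT_comp (oracle_meas o) (measurable_fun_pair mY mZ)).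
have mg := continuous_measurable_borelRn (@continuous_grad_coord i).
have := measurableT_comp mg mY; rewrite /comp/=.
by under eq_fun do rewrite mxE.
Qed.

Local Open Scope ereal_scope.

(** When the square is expanded, unbiasedness cancels the cross term. *)
Lemma unbiased_shift x a : unbiased_at f o sigma x ->
  \int[oracle_law o x]_z (enorm (a + oracle_error x z) ^+ 2)%:E
    <= (enorm a ^+ 2 + sigma ^+ 2)%:E.
Proof.
move=> [bias var]; set k := oracle_law o x.
have mX i : measurable_fun setT (fun z => oracle_error x z ord0 i).
  exact: (measurable_oracle_error _ (measurable_cst (x : borelRn R n))).
have mX2 : measurable_fun setT (fun z => (enorm (oracle_error x z) ^+ 2)%R).
  exact: measurable_sqr_enorm.
have iX2 : k.-integrable setT (fun z => (enorm (oracle_error x z) ^+ 2)%:E).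
  apply/integrableP; split; first exact/measurable_EFinP.
  rewrite (le_lt_trans _ (ltry (sigma ^+ 2)%R))// (le_trans _ var)//.
  by under eq_integral do rewrite gee0_abs ?lee_fin ?sqr_ge0//.
have k1 : k setT = 1 by exact: prob_kernel.
have ic (r : R) : k.-integrable setT (fun=> r%:E).
  apply/integrableP; split; first exact: measurable_cst.
  by rewrite integral_cst// k1 mule1 ltry.
(* A coordinate is at most one plus the squared norm, so the finite second moment makes it
   integrable and the expanded integral may be split. *)
have iX i : k.-integrable setT (fun z => (oracle_error x z ord0 i)%:E).
  apply: (@le_integrable _ _ _ _ _ _ _
    (fun z => 1%:E + (enorm (oracle_error x z) ^+ 2)%:E)) => //.
  - exact/measurable_EFinP.
  - move=> z _; rewrite -EFinD /= lee_fin [leRHS]ger0_norm; last by rewrite addr_ge0 ?sqr_ge0.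
    have := enorm_coord (oracle_error x z) i.
    have := enorm_ge0 (oracle_error x z); nra.
  - exact: integrableD.
have X0 i : \int[k]_z (oracle_error x z ord0 i)%:E = 0.
  have Gi z : (oracle_grad o x z ord0 i
      = oracle_error x z ord0 i + grad f x ord0 i)%R by rewrite !mxE subrK.
  have := bias i; under eq_integral do rewrite Gi EFinD.
  rewrite integralD// integral_cst// k1 mule1.
  have : \int[k]_z (oracle_error x z ord0 i)%:E \is a fin_num.
    exact: integrable_fin_num.
  case: (\int[k]_z _) => // r _; rewrite -EFinD => -[] /eqP.
  by rewrite -subr_eq0 addrK => /eqP ->.
have -> : \int[k]_z (enorm (a + oracle_error x z) ^+ 2)%:E
    = \int[k]_z ((enorm a ^+ 2)%:E
        + (\sum_i (2 * a ord0 i)%:E * (oracle_error x z ord0 i)%:E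
           + (enorm (oracle_error x z) ^+ 2)%:E)).
  apply: eq_integral => z _; rewrite sqr_enormD -addrA !EFinD; congr (_ + (_ + _)).
  rewrite sumEFin; congr (_%:E); rewrite mulr_sumr.
  by apply: eq_bigr => i _; rewrite mulrA.
have iaX i : k.-integrable setT
    (fun z => (2 * a ord0 i)%:E * (oracle_error x z ord0 i)%:E).
  exact: integrableZl.
have iS : k.-integrable setT
    (fun z => \sum_i (2 * a ord0 i)%:E * (oracle_error x z ord0 i)%:E).
  exact: (integrable_sum measurableT).
rewrite integralD//; last exact: integrableD.
rewrite integralD// (integral_sum measurableT iaX).
rewrite integral_cst// k1 mule1 big1 ?add0e ?EFinD ?leeD2l//.
by move=> i _; rewrite integralZl// X0 mule0.
Qed.

Context d (Omega : measurableType d) (P : probability Omega R)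
  (G : set_system Omega).
Hypothesis GM : G `<=` @measurable _ Omega.
Variables (Y : Omega -> 'rV[R]_n) (Z : Omega -> Xi) (S : Omega -> 'rV[R]_n).
Hypotheses (mY : measurable_fun setT (Y : g_sigma_algebraType G -> borelRn R n))
  (mZ : measurable_fun setT Z)
  (mS : forall i, measurable_fun setT
     ((fun w => S w ord0 i) : g_sigma_algebraType G -> R)).
Hypothesis law : forall A B, <<s G >> A -> measurable B ->
  P (A `&` Z @^-1` B) = \int[P]_(w in A) oracle_law o (Y w) B.

(** Given [G], the partial sum [S] and the point [Y] are fixed and only the new sample is random, so
    [unbiased_shift] applies under the conditional law: martingale increments are orthogonal. *)
Lemma variance_step A : <<s G >> A ->
  (forall w, A w -> unbiased_at f o sigma (Y w)) ->
  \int[P]_(w in A) (enorm (S w + oracle_error (Y w) (Z w)) ^+ 2)%:E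
    <= \int[P]_(w in A) (enorm (S w) ^+ 2)%:E + (sigma ^+ 2)%:E * P A.
Proof.
move=> GA unb.
have mA : measurable A by exact: sub_sigma_algebra_measurable GA.
have mAG : measurable (A : set (g_sigma_algebraType G)) by [].
(* The indicator goes inside the integrand because unbiasedness is available on [A] only. *)
pose h (p : g_sigma_algebraType G * Xi) :=
  (\1_A p.1 * enorm (S p.1 + oracle_error (Y p.1) p.2) ^+ 2)%:E.
have mSA : measurable_fun setT
    ((fun w => (enorm (S w) ^+ 2)%:E) : g_sigma_algebraType G -> \bar R).
  by apply/measurable_EFinP; exact: measurable_sqr_enorm.
have mSA' := measurable_fun_sub GM mSA.
rewrite integral_mkcond.
rewrite (_ : \int[P]_w _ = \int[P]_w h (w, Z w)); last first.
  apply: eq_integral => w _; rewrite /h /= patchE indicE.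
  by case: ifP; rewrite ?mul1r ?mul0r.
rewrite (integral_conditional_law GM mY mZ law); last 2 first.
- by move=> p; rewrite lee_fin mulr_ge0 ?sqr_ge0.
- apply/measurable_EFinP; apply: measurable_funM.
    exact: (measurableT_comp (measurable_indic mAG) measurable_fst).
  apply: measurable_sqr_enorm => i; under eq_fun do rewrite mxE.
  apply: measurable_funD; first exact: (measurableT_comp (mS i) measurable_fst).
  apply: measurable_oracle_error; last exact: measurable_snd.
  exact: (measurableT_comp mY measurable_fst).
have -> : \int[P]_(w in A) (enorm (S w) ^+ 2)%:E + (sigma ^+ 2)%:E * P A
    = \int[P]_(w in A) (enorm (S w) ^+ 2 + sigma ^+ 2)%:E.
  under [RHS]eq_integral do rewrite EFinD.
  rewrite ge0_integralD//; last 3 first.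
  - by move=> w _; rewrite lee_fin sqr_ge0.
  - exact: (measurable_funS measurableT).
  - by move=> w _; rewrite lee_fin sqr_ge0.
  by congr (_ + _); rewrite (integral_cst P mA).
rewrite [leRHS]integral_mkcond; apply: ae_le_integral.
- by move=> w; apply: integral_ge0 => z _; rewrite lee_fin mulr_ge0 ?sqr_ge0.
- move=> w; rewrite patchE; case: ifP => // _.
  by rewrite lee_fin addr_ge0 ?sqr_ge0.
- apply/(measurable_restrictT _ mA); apply: (measurable_funS measurableT) => //.
  under eq_fun do rewrite EFinD; apply: emeasurable_funD => //.
- apply/aeW => w; rewrite patchE /h /=; case: ifPn => wA.
    under eq_integral do rewrite indicE wA mul1r.
    by apply: unbiased_shift; apply/unb/set_mem.
  by rewrite integral0_eq// => z _; rewrite indicE (negbTE wA) mul0r.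
Qed.

End Oracle.

(** * Information and sampling error within one call *)

Section Run.
Context {R : realType} (n q : nat).
Variables (f : 'rV[R]_n -> R) (c : 'rV[R]_n -> 'rV[R]_q) (flow Lg LJ : R).
Hypothesis as1 : AS1 f c flow Lg LJ.
Context dX (Xi : measurableType dX) (o : oracle R n Xi) (sigma : R).
Context d (Omega : measurableType d) (P : probability Omega R).
Variables (batch : R -> nat -> nat) (t : trajectory R n Xi Omega).
Variables (N : nat) (eps xi tau rho0 : R) (x1 G1 : 'rV[R]_n).

Let gamma (rho : R) := 1 / L_ Lg LJ rho.

Hypothesis run : algP c P o gamma batch N eps xi tau rho0 x1 G1 t.

Lemma events_sub d' (T : measurableType d') (X : Omega -> T) :
  measurable_fun setT X -> events X `<=` @measurable _ Omega.
Proof. by move=> mX _ [B mB <-]; exact: mX. Qed.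

Lemma measurable_fun_events d' (T : measurableType d') (G : set_system Omega)
    (X : Omega -> T) :
  events X `<=` G -> measurable_fun setT (X : g_sigma_algebraType G -> T).
Proof.
by move=> XG _ B mB; apply: sub_sigma_algebra; apply: XG; exists B.
Qed.

Variable k : nat.
Hypothesis kN : (0 < k < N)%N.

Lemma past_measurable : past t k `<=` @measurable _ Omega.
Proof.
have /andP[k0 kltN] := kN.
move=> A [[l /= /andP[l0 lk]]|[l /= /andP[l0 lk]]].
  have lN : (0 < l < N)%N by rewrite l0 (leq_ltn_trans lk).
  case; apply: events_sub; first exact: (algP_meas_rho run).
  exact: (algP_meas_Nbar run).
have lN : (0 < l < N)%N by rewrite l0 (ltn_trans lk).
have aS := algP_algS run lN.
case=> [|[j /= j0] [|[i _]]]; apply: events_sub.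
- exact: (algS_meas_R aS).
- exact: (algS_meas_y aS).
- exact: (algS_meas_zeta aS).
Qed.

Lemma past_sample_measurable j i : past_sample t k j i `<=` @measurable _ Omega.
Proof.
have aS := algP_algS run kN.
move=> A [[|[l /= /andP[l0 _]]]|[p /= [p0 _]]]; first exact: past_measurable.
  by apply: events_sub; exact: (algS_meas_y aS).
by apply: events_sub; exact: (algS_meas_zeta aS).
Qed.

Lemma past_call_measurable : past_call t k `<=` @measurable _ Omega.
Proof.
have aS := algP_algS run kN.
move=> A [|[j /= j0] [|[i _]]]; first exact: past_measurable.
  by apply: events_sub; exact: (algS_meas_y aS).
by apply: events_sub; exact: (algS_meas_zeta aS).
Qed.

Lemma past_sub_sample j i : <<s past t k >> `<=` <<s past_sample t k j i >>.
Proof. by apply: sub_sigma_algebra2 => A tA; left; left. Qed.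

Lemma past_sub_call : <<s past t k >> `<=` <<s past_call t k >>.
Proof. by apply: sub_sigma_algebra2 => A tA; left. Qed.

Definition sample_error j i w := oracle_error f o (y_ t k j w) (zeta_ t k j i w).

(** The number of terms is deterministic, to allow induction on it; [batch_errorE] substitutes the
    random batch size. *)
Definition error_sum j m w : 'rV[R]_n := \sum_(i < m) sample_error j i w.

(** [G] is left open because the lemma serves both for what precedes a sample and for the whole
    call. *)
Lemma measurable_error_sum (G : set_system Omega) j m i :
  events (y_ t k j : Omega -> borelRn R n) `<=` G ->
  (forall l, (l < m)%N -> events (zeta_ t k j l) `<=` G) ->
  measurable_fun setT
    ((fun w => error_sum j m w ord0 i) : g_sigma_algebraType G -> R).
Proof.
move=> yG zG; under eq_fun do rewrite summxE.
apply: measurable_sum => l; apply: measurable_oracle_error.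
- exact: AS1_cgrad as1.
- exact: measurable_fun_events.
- by apply: measurable_fun_events; exact: zG.
Qed.

Local Open Scope ereal_scope.

(** Samples are added one at a time. The sum of the previous ones is known to [past_sample], so
    variances add up and the bound grows like [m], not [m ^ 2]. *)
Lemma error_sum_bound j A m : (0 < j)%N -> <<s past t k >> A ->
  (forall w, A w -> unbiased_at f o sigma (y_ t k j w)) ->
  \int[P]_(w in A) (enorm (error_sum j m w) ^+ 2)%:E
    <= (m%:R * sigma ^+ 2)%:E * P A.
Proof.
move=> j0 pA unb; elim: m => [|m IH].
  rewrite mul0r mul0e integral0_eq// => w _.
  by rewrite /error_sum big_ord0 enorm0 expr0n.
have aS := algP_algS run kN.
under eq_integral do rewrite /error_sum big_ord_recr /=.
have jG : events (y_ t k j : Omega -> borelRn R n) `<=` past_sample t k j m.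
  by move=> B yB; left; right; exists j => //=; rewrite j0 /=.
have zG l : (l < m)%N -> events (zeta_ t k j l) `<=` past_sample t k j m.
  by move=> lm B zB; right; exists (j, l) => //=; split => //; right.
apply: (le_trans (variance_step (AS1_cgrad as1) (sigma := sigma)
  (@past_sample_measurable j m) (measurable_fun_events jG)
  (algS_meas_zeta aS m j0) (S := error_sum j m)
  (fun i => measurable_error_sum i jG zG) _ (past_sub_sample pA) unb)).
  by move=> B C; exact: (algS_sample aS).
have s0 : 0 <= (sigma ^+ 2)%:E by rewrite lee_fin sqr_ge0.
have ms0 : 0 <= (m%:R * sigma ^+ 2)%:E by rewrite lee_fin mulr_ge0 ?sqr_ge0.
by rewrite -natr1 mulrDl mul1r EFinD ge0_muleDl// leeD2r.
Qed.

Definition batch_error j w : 'rV[R]_n :=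
  (Gbar o batch t k j w - grad f (y_ t k j w))%R.

Lemma batch_errorE j w : (0 < m_ batch t k w)%N ->
  batch_error j w
    = ((m_ batch t k w)%:R^-1 *: error_sum j (m_ batch t k w) w)%R.
Proof.
move=> m0; rewrite /batch_error /Gbar /error_sum.
under [in RHS]eq_bigr do rewrite /sample_error /oracle_error.
rewrite sumrB sumr_const card_ord scalerBr -[(grad _ _ *+ _)%R]scaler_nat scalerA.
by rewrite mulVf ?scale1r// pnatr_eq0 -lt0n.
Qed.

Lemma batch_error_bound j A m : (0 < j)%N -> (0 < m)%N -> <<s past t k >> A ->
  (forall w, A w -> m_ batch t k w = m) ->
  (forall w, A w -> unbiased_at f o sigma (y_ t k j w)) ->
  \int[P]_(w in A) (enorm (batch_error j w) ^+ 2)%:E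
    <= (sigma ^+ 2 / m%:R)%:E * P A.
Proof.
move=> j0 m0 pA Am unb.
have mA : measurable A := sub_sigma_algebra_measurable past_measurable pA.
rewrite (_ : \int[P]_(w in A) _ = \int[P]_(w in A)
    ((m%:R ^- 2)%:E * (enorm (error_sum j m w) ^+ 2)%:E)); last first.
  apply: eq_integral => w /set_mem/Am mE; rewrite batch_errorE ?mE//.
  by rewrite enormZ exprMn real_normK ?num_real// exprVn.
rewrite ge0_integralZl_EFin//; last 2 first.
- by move=> w _; rewrite lee_fin sqr_ge0.
- apply: (measurable_funS measurableT) => //; apply/measurable_EFinP.
  apply: measurable_sqr_enorm => i.
  have aS := algP_algS run kN.
  apply: (measurable_fun_sub past_call_measurable).
  apply: measurable_error_sum => [B yB|l lm B zB].
    by right; exists j => //; left.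
  by right; exists j => //; right; exists l.
have := error_sum_bound m j0 pA unb.
move=> /(@lee_wpmul2l _ (m%:R ^- 2)%:E) H.
apply: (le_trans (H _)); first by rewrite lee_fin invr_ge0 exprn_ge0.
rewrite muleA -EFinM.
by rewrite (_ : (m%:R ^- 2 * _ = sigma ^+ 2 / m%:R)%R)//; field; rewrite pnatr_eq0 -lt0n.
Qed.

End Run.

(** * Expected decrease at the random index *)

Section Gap.
Context {R : realType} (n q : nat).
Variables (f : 'rV[R]_n -> R) (c : 'rV[R]_n -> 'rV[R]_q) (flow Lg LJ : R).
Hypotheses (Lg0 : 0 < Lg) (LJ0 : 0 < LJ) (as1 : AS1 f c flow Lg LJ).
Context dX (Xi : measurableType dX) (o : oracle R n Xi) (sigma : R).
Context d (Omega : measurableType d) (P : probability Omega R).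
Variables (batch : R -> nat -> nat) (t : trajectory R n Xi Omega).
Variables (N : nat) (eps xi tau rho0 : R) (x1 G1 : 'rV[R]_n).
Let gamma (rho : R) := 1 / L_ Lg LJ rho.
Hypothesis run : algP c P o gamma batch N eps xi tau rho0 x1 G1 t.
Hypothesis as4 : AS4 f o batch sigma N t.
Variable k : nat.
Hypothesis kN : (0 < k < N)%N.
Hypothesis rho_gt0 : forall w, 0 < rho_ t k w.
Hypothesis m_gt0 : forall w, (0 < m_ batch t k w)%N.
Hypothesis mm :
  measurable_fun setT (m_ batch t k : g_sigma_algebraType (past t k) -> nat).

Let L w := L_ Lg LJ (rho_ t k w).
Let L_gt0 w : 0 < L w.
Proof. by rewrite /L /L_ ltr_pwDl// mulr_ge0 ?ltW. Qed.

(* An upper bound, known after the call, on [2 L] times the decrease that a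
   proximal step with the exact gradient would achieve at [y_ t k j]. *)
Definition gap j w : R :=
  2 * L w * (Phi f c (rho_ t k w) (y_ t k j w)
             - Phi f c (rho_ t k w) (y_ t k j.+1 w))
  + enorm (batch_error f o batch t k j w) ^+ 2.

Lemma gapP j w : (0 < j)%N ->
  prox_decrease_le f c Lg LJ (rho_ t k w) (y_ t k j w) (gap j w / (2 * L w)).
Proof.
move=> j0 u; have := algS_step (algP_algS run kN) w j0.
move=> /(prox_step_descent Lg0 LJ0 as1 u (ltW (rho_gt0 w))).
have -> : gap j w / (2 * L w)
  = Phi f c (rho_ t k w) (y_ t k j w) - Phi f c (rho_ t k w) (y_ t k j.+1 w)
    + enorm (batch_error f o batch t k j w) ^+ 2 / (2 * L w).
  by rewrite /gap; field; rewrite gt_eqF.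
rewrite /batch_error -/(L w) {2}/Phi; lra.
Qed.

(** The test point is the current point. Thanks to the sign, [gap] is integrated as a nonnegative
    function, without any integrability of [Phi] along the run. *)
Lemma gap_ge0 j w : (0 < j)%N -> 0 <= gap j w.
Proof.
move=> j0; have := gapP w j0 (y_ t k j w).
rewrite /prox_obj subrr mul0mx addr0 dotC dot0l enorm0 expr0n mulr0 addr0 add0r.
by rewrite subrr pmulr_lge0// invr_gt0 mulr_gt0.
Qed.

Lemma measurable_fun_past_call d' (T : measurableType d') (X : Omega -> T) :
  measurable_fun setT (X : g_sigma_algebraType (past t k) -> T) ->
  measurable_fun setT (X : g_sigma_algebraType (past_call t k) -> T).
Proof. by move=> mX A B mB; apply: past_sub_call; exact: mX. Qed.

Lemma measurable_rho :
  measurable_fun setT (rho_ t k : g_sigma_algebraType (past t k) -> R).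
Proof.
have /andP[k0 _] := kN; apply: measurable_fun_events => A rA.
by left; exists k => /=; [rewrite k0 leqnn|left].
Qed.

Lemma measurable_Nbar :
  measurable_fun setT (Nbar_ t k : g_sigma_algebraType (past t k) -> nat).
Proof.
have /andP[k0 _] := kN; apply: measurable_fun_events => A rA.
by left; exists k => /=; [rewrite k0 leqnn|right].
Qed.

Lemma measurable_Nin :
  measurable_fun setT (Nin batch t k : g_sigma_algebraType (past t k) -> nat).
Proof.
apply: (@measurable_fun_index _ (g_sigma_algebraType (past t k)) _ _ (Nbar_ t k)
  (fun a w => natceil (a%:R / (m_ batch t k w)%:R : R))) => [|a].
  exact: measurable_Nbar.
exact: (@measurable_fun_index _ (g_sigma_algebraType (past t k)) _ _
  (m_ batch t k) (fun b _ => natceil (a%:R / b%:R : R))).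
Qed.

Lemma measurable_Phi d' (T : measurableType d') (r : T -> R) (Y : T -> borelRn R n) :
  measurable_fun setT r -> measurable_fun setT Y ->
  measurable_fun setT (fun w => Phi f c (r w) (Y w)).
Proof.
move=> mr mY.
have cf : continuous f.
  by move=> x; apply: differentiable_continuous; exact: (AS1_df as1).
apply: measurable_funD.
  exact: (measurableT_comp (continuous_measurable_borelRn cf) mY).
apply: measurable_funM => //.
have msqrt : measurable_fun setT (@Num.sqrt R).
  by apply: continuous_measurable_fun; exact: sqrt_continuous.
apply: (measurableT_comp msqrt).
under eq_fun do rewrite -sqr_enorm.
apply: measurable_sqr_enorm => i.
have cc : continuous (fun x => c x ord0 i).
  move=> x; have cx : {for x, continuous c}.
    by apply: differentiable_continuous; exact: (AS1_dc as1).
  exact: (cvg_comp _ _ cx (@coord_continuous R 1 q ord0 i (c x))).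
exact: (measurableT_comp (continuous_measurable_borelRn cc) mY).
Qed.

Lemma measurable_batch_error j : (0 < j)%N ->
  measurable_fun setT ((fun w => enorm (batch_error f o batch t k j w) ^+ 2)
    : g_sigma_algebraType (past_call t k) -> R).
Proof.
move=> j0.
rewrite (_ : (fun w => _) = (fun w => enorm ((m_ batch t k w)%:R^-1
    *: error_sum f o t k j (m_ batch t k w) w) ^+ 2)); last first.
  by apply/funext => w; rewrite batch_errorE.
apply: (@measurable_fun_index _ (g_sigma_algebraType (past_call t k)) _ _
  (m_ batch t k) (fun m w => enorm (m%:R^-1 *: error_sum f o t k j m w) ^+ 2)).
  exact: measurable_fun_past_call.
move=> m; apply: measurable_sqr_enorm => i; under eq_fun do rewrite mxE.
apply: measurable_funM => //; apply: (measurable_error_sum as1) => [B yB|l _ B zB].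
  by right; exists j => //; left.
by right; exists j => //; right; exists l.
Qed.

Lemma measurable_gap j : (0 < j)%N ->
  measurable_fun setT (gap j : g_sigma_algebraType (past_call t k) -> R).
Proof.
move=> j0.
have my l : (0 < l)%N -> measurable_fun setT
    (y_ t k l : g_sigma_algebraType (past_call t k) -> borelRn R n).
  move=> l0; apply: measurable_fun_events => B yB.
  by right; exists l => //; left.
have mrho := measurable_fun_past_call measurable_rho.
apply: measurable_funD; last exact: measurable_batch_error.
apply: measurable_funM.
  apply: measurable_funM => //; apply: measurable_funD => //.
  exact: measurable_funM.
by apply: measurable_funB; apply: measurable_Phi => //; exact: my.
Qed.

Local Open Scope ereal_scope.

(** On [A] the index is uniform on [n0] values, so the integral is an average of the gaps over the
    call. The share [e1] covers the telescoped decrease per iteration, and [e2] the variance of a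
    batch. *)
Lemma integral_gap_const (e1 e2 : R) Plow A n0 m0 : (0 < n0)%N -> (0 < m0)%N -> (0 <= e1)%R ->
  (forall rho x, (0 < rho)%R -> (Plow rho <= Phi f c rho x)%R) ->
  <<s past t k >> A ->
  (forall w, A w -> Nin batch t k w = n0) ->
  (forall w, A w -> m_ batch t k w = m0) ->
  (forall w, A w -> 2 * L w * (Phi f c (rho_ t k w) (x_ t k w) - Plow (rho_ t k w))
               <= e1 * n0%:R)%R ->
  (sigma ^+ 2 <= e2 * m0%:R)%R ->
  \int[P]_(w in A) (gap (R_ t k w) w)%:E <= (e1 + e2)%:E * P A.
Proof.
move=> n0_gt0 m0_gt0 e1_ge0 PlowP pA An Am De1 se2.
have aS := algP_algS run kN.
have pm := past_measurable run kN.
have pcm := past_call_measurable run kN.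
have mA : measurable A := sub_sigma_algebra_measurable pm pA.
have mR j : measurable (R_ t k @^-1` [set j]).
  by rewrite -[X in measurable X]setTI; exact: (algS_meas_R aS).
have mgap j : (0 < j)%N -> measurable_fun setT (EFin \o gap j : Omega -> \bar R).
  move=> j0; apply/measurable_EFinP.
  exact: (measurable_fun_sub pcm (measurable_gap j0)).
have RA w : A w -> (0 < R_ t k w <= n0)%N.
  by move=> Aw; rewrite -(An _ Aw); exact: (algS_range aS).
(* Independence of the random index enters here: [gap j.+1] depends only on [past_call]. *)
have prop (j : 'I_n0) : \int[P]_(w in A `&` R_ t k @^-1` [set j.+1]) (gap j.+1 w)%:E
   = (n0%:R^-1)%:E * \int[P]_(w in A) (gap j.+1 w)%:E.
  have a0 : (0 <= n0%:R^-1 :> R)%R by [].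
  apply: (@integral_proportional _ _ _ P (past_call t k) _ A (NngNum a0)
    pcm (measurableI _ _ mA (mR _)) mA _ (EFin \o gap j.+1)).
  - move=> B cB; rewrite setIA.
    have cBA : <<s past_call t k >> (B `&` A).
      have mB : measurable (B : set (g_sigma_algebraType (past_call t k))) by [].
      have mA' : measurable (A : set (g_sigma_algebraType (past_call t k))).
        exact: past_sub_call.
      exact: (measurableI _ _ mB mA').
    rewrite -[LHS]/(P (B `&` A `&` [set w | R_ t k w = j.+1])).
    rewrite (algS_index aS j.+1 cBA).
    rewrite -(integral_cst P (D := B `&` A)); last first.
      exact: sub_sigma_algebra_measurable cBA.
    by apply: eq_integral => w /set_mem[_ Aw]; rewrite (An _ Aw) /= ltn_ord.
  - by apply/measurable_EFinP; exact: measurable_gap.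
  - by move=> w; rewrite lee_fin gap_ge0.
have mgA j : (0 < j)%N -> measurable_fun A (EFin \o gap j).
  by move=> j0; apply: (measurable_funS measurableT) => //; exact: mgap.
have splitA : \int[P]_(w in A) (gap (R_ t k w) w)%:E
    = \sum_(j < n0) \int[P]_(w in A `&` R_ t k @^-1` [set j.+1]) (gap j.+1 w)%:E.
  under [RHS]eq_bigr do rewrite integral_mkcondr.
  rewrite -ge0_integral_sum//.
  - apply: eq_integral => w /set_mem Aw; have /andP[R0 Rn] := RA _ Aw.
    have Rlt : ((R_ t k w).-1 < n0)%N by rewrite prednK.
    rewrite (bigD1 (Ordinal Rlt))//= big1 ?adde0 => [|j jR].
      by rewrite patchE mem_set/= ?prednK.
    rewrite patchE memNset//= => Rj; move/eqP: jR; apply.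
    by apply: val_inj; rewrite /= Rj.
  - by move=> j; apply/(measurable_restrict _ _ _).1 => //; exact: measurable_funS (mgap _ _).
  - by move=> j w _; rewrite patchE; case: ifP => // _; rewrite lee_fin gap_ge0.
have mbe j : (0 < j)%N ->
    measurable_fun A (fun w => (enorm (batch_error f o batch t k j w) ^+ 2)%:E).
  move=> j0; apply: (measurable_funS measurableT) => //; apply/measurable_EFinP.
  exact: (measurable_fun_sub pcm (measurable_batch_error j0)).
(* [L] is the same throughout the call, so the decreases of [Phi] telescope; [Plow] then bounds the
   last value. *)
have tel m w : (\sum_(j < m) gap j.+1 w)%R
    = (2 * L w * (Phi f c (rho_ t k w) (y_ t k 1 w)
                  - Phi f c (rho_ t k w) (y_ t k m.+1 w))
       + \sum_(j < m) enorm (batch_error f o batch t k j.+1 w) ^+ 2)%R.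
  elim: m => [|m IH]; first by rewrite !big_ord0 subrr mulr0 addr0.
  by rewrite !big_ord_recr/= IH /gap; ring.
have e2m : (sigma ^+ 2 / m0%:R <= e2)%R by rewrite ler_pdivrMr ?ltr0n.
have be_bound (j : 'I_n0) :
    \int[P]_(w in A) (enorm (batch_error f o batch t k j.+1 w) ^+ 2)%:E
      <= e2%:E * P A.
  apply: (le_trans (batch_error_bound as1 run kN (ltn0Sn j) m0_gt0 pA Am _)).
    by move=> w Aw; apply: as4 => //; rewrite (An _ Aw) ltn_ord.
  by rewrite lee_wpmul2r ?lee_fin.
have sum_le : \int[P]_(w in A) (\sum_(j < n0) gap j.+1 w)%R%:E
    <= (n0%:R * (e1 + e2))%:E * P A.
  apply: (@le_trans _ _ (\int[P]_(w in A) ((e1 * n0%:R)%:E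
      + \sum_(j < n0) (enorm (batch_error f o batch t k j.+1 w) ^+ 2)%:E))).
    apply: ge0_le_integral => //.
    - by move=> w _; rewrite lee_fin sumr_ge0// => j _; exact: gap_ge0.
    - under eq_fun do rewrite -sumEFin; apply: emeasurable_sum => j.
      exact: mgA.
    - apply: emeasurable_funD => //; apply: emeasurable_sum => j; exact: mbe.
    - move=> w Aw; rewrite tel sumEFin -EFinD lee_fin lerD2r.
      apply: le_trans (De1 _ Aw); rewrite (algS_init aS).
      by rewrite ler_wpM2l ?mulr_ge0 ?(ltW (L_gt0 w))// lerD2l lerN2 PlowP.
  rewrite ge0_integralD//; last 3 first.
  - by move=> w _; rewrite lee_fin mulr_ge0.
  - by move=> w _; apply: sume_ge0 => j _; rewrite lee_fin sqr_ge0.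
  - by apply: emeasurable_sum => j; exact: mbe.
  rewrite (integral_cst P mA) ge0_integral_sum//; last 2 first.
  - by move=> j; exact: mbe.
  - by move=> j w _; rewrite lee_fin sqr_ge0.
  apply: (@le_trans _ _ ((e1 * n0%:R)%:E * P A + \sum_(j < n0) e2%:E * P A)).
    by rewrite leeD2l// lee_sum.
  have e2_ge0 : (0 <= e2)%R by apply: le_trans e2m; rewrite divr_ge0 ?sqr_ge0.
  rewrite -ge0_sume_distrl; last by move=> j _; rewrite lee_fin.
  rewrite sumEFin sumr_const card_ord -ge0_muleDl ?lee_fin ?mulr_ge0 ?mulrn_wge0//.
  by rewrite -EFinD mulrDr -[(e2 *+ n0)%R]mulr_natl [(e1 * _)%R]mulrC.
rewrite splitA; under eq_bigr do rewrite prop.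
rewrite -ge0_sume_distrr; last first.
  by move=> j _; apply: integral_ge0 => w _; rewrite lee_fin gap_ge0.
rewrite -(@ge0_integral_sum _ _ _ P A mA 'I_n0 (fun j w => (gap j.+1 w)%:E)); last 2 first.
- by move=> j; exact: mgA.
- by move=> j w _; rewrite lee_fin gap_ge0.
under eq_integral do rewrite sumEFin.
have n0V : 0 <= (n0%:R^-1 : R)%:E by rewrite lee_fin.
apply: (le_trans (lee_wpmul2l n0V sum_le)).
rewrite muleA -EFinM mulrA mulVf ?mul1r// pnatr_eq0 -lt0n//.
Qed.

End Gap.

(** * Choice of batch size and number of oracle calls *)

Section BatchParams.
Context {R : realType}.

Lemma natceil_ge (r : R) : r <= (natceil r)%:R.
Proof.
rewrite (le_trans (ceil_ge r))// /natceil natr_absz ler_int.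
exact: ler_norm.
Qed.

Lemma natceil_lt (r : R) : 0 <= r -> (natceil r)%:R < r + 1.
Proof.
move=> r0; have c0 : 0 <= Num.ceil r by rewrite -(ceil0 R) ceil_le.
have -> : (natceil r)%:R = (Num.ceil r)%:~R :> R.
  by rewrite /natceil natr_absz ger0_norm.
by rewrite -ltrBlDr; have /andP[] := ceil_itv r; rewrite intrB.
Qed.

Lemma natceil_le_nat (r : R) (a : nat) : r <= a%:R -> 0 <= r -> (natceil r <= a)%N.
Proof.
move=> ra r0; have := natceil_lt r0; rewrite -ltnS -(ltr_nat R) -natr1.
by move=> /lt_le_trans; apply; rewrite lerD2r.
Qed.

Lemma measurable_natceil : measurable_fun setT (natceil : R -> nat).
Proof.
move=> _ B _; rewrite setTI.
(* The absolute value in [natceil] forgets the sign, hence two level sets for each [k]. *)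
have -> : natceil @^-1` B = \bigcup_(k in B)
    ([set r : R | Num.ceil r = k%:Z] `|` [set r : R | Num.ceil r = - k%:Z]).
  apply/seteqP; split=> [r Br|r [k Bk] /= cr].
    exists (natceil r) => //=; rewrite /natceil abszE.
    by case: (ger0P (Num.ceil r)) => _; [left|right]; rewrite ?opprK.
  suff -> : natceil r = k by [].
  by rewrite /natceil; case: cr => ->; rewrite ?abszN absz_nat.
have mz (z : int) : measurable [set r : R | Num.ceil r = z].
  rewrite (_ : mkset _ = `](z - 1)%:~R, z%:~R]%classic)//.
  apply/seteqP; split=> r /=; rewrite in_itv/=.
    by move=> <-; exact: ceil_itv.
  exact: ceil_def.
by apply: bigcup_measurable => k _; apply: measurableU; exact: mz.
Qed.

Variables (Lg LJ sigma Dt : R).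
Hypotheses (Lg0 : 0 < Lg) (LJ0 : 0 < LJ) (sigma0 : 0 < sigma) (Dt0 : 0 < Dt).

Lemma L_gt0 rho : 0 < rho -> 0 < L_ Lg LJ rho.
Proof. by move=> rho0; rewrite /L_ addr_gt0// mulr_gt0. Qed.

Variables (eps rho D : R) (Nb : nat).
Hypotheses (eps0 : 0 < eps) (rho_gt0 : 0 < rho) (D0 : 0 <= D).
Hypothesis NbP : Nbar_min Lg LJ sigma Dt eps rho D <= Nb%:R.

Let L := L_ Lg LJ rho.
Let m := batch_size Lg LJ sigma Dt rho Nb.

(** The inequalities are the two shares [eps / 4]: one for the decrease divided by [Nb / m]
    iterations, one for the variance [sigma ^+ 2 / m]. *)
Lemma batch_size_bounds :
  [/\ (0 < m)%N, 2 * L * D * m%:R <= eps / 4 * Nb%:R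
    & sigma ^+ 2 <= eps / 4 * m%:R].
Proof.
have L0 : 0 < L by exact: L_gt0.
set r := Num.sqrt Nb%:R : R; set e := Num.sqrt Dt.
have e0 : 0 < e by rewrite sqrtr_gt0.
have e2 : e ^+ 2 = Dt by rewrite sqr_sqrtr// ltW.
have r2 : r ^+ 2 = Nb%:R by rewrite sqr_sqrtr.
have C30 : 0 < C3 sigma Dt by rewrite !mulr_gt0.
have C20 : 0 < C2 sigma Dt by rewrite divr_gt0// mulr_gt0.
have := NbP; rewrite /Nbar_min ge_max -/L => /andP[h1 h2].
have LD : 0 <= 128 * L * D / eps by rewrite !mulr_ge0 ?invr_ge0 ?(ltW L0) ?(ltW eps0).
set T := 4 * D * C2 sigma Dt + 4 * L * C3 sigma Dt in h1.
have T0 : 0 < T.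
  apply: ltr_wpDl; first by rewrite mulr_ge0 ?(ltW C20)// mulr_ge0.
  by rewrite !mulr_gt0.
have h3 : T ^+ 2 / eps ^+ 2 <= r ^+ 2 by rewrite r2; lra.
have h4 : 128 * L * D / eps <= r ^+ 2.
  have : 0 <= T ^+ 2 / eps ^+ 2 by rewrite divr_ge0 ?sqr_ge0.
  by rewrite r2; lra.
have r_ge0 : 0 <= r by exact: sqrtr_ge0.
have h5 : T <= eps * r.
  rewrite -(@ler_pXn2r _ 2)// ?nnegrE ?mulr_ge0 ?(ltW T0) ?(ltW eps0)//.
  by rewrite exprMn mulrC -ler_pdivrMr ?exprn_gt0.
have r0 : 0 < r.
  by rewrite -(pmulr_rgt0 _ eps0); exact: (lt_le_trans T0 h5).
pose a := sigma / L * (r / e).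
have aE : sigma / L * Num.sqrt (Nb%:R / Dt) = a by rewrite sqrtrM// sqrtrV ?(ltW Dt0).
have a0 : 0 < a by rewrite mulr_gt0// divr_gt0.
(* The branch [C1 / L ^+ 2] of [Nbar_min] serves to make the cap at [Nb] in the batch size
   inactive. *)
have aN : a <= Nb%:R.
  have h6 : sigma / (e * L) <= r.
    rewrite -(@ler_pXn2r _ 2)// ?nnegrE//; last first.
      by rewrite divr_ge0 ?(ltW sigma0)// mulr_ge0 ?(ltW L0)// ltW.
    have -> : (sigma / (e * L)) ^+ 2 = C1 sigma Dt / L ^+ 2.
      by rewrite /C1 -e2; field; rewrite !gt_eqF.
    by rewrite r2.
  have -> : a = sigma / (e * L) * r by rewrite /a; field; rewrite !gt_eqF.
  by rewrite -r2 expr2 ler_wpM2r.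
have Nb1 : 1 <= Nb%:R :> R.
  by rewrite ler1n lt0n -(eqr_nat R) -r2 expf_eq0 /= gt_eqF.
have mE : m = natceil (Num.max 1 a).
  by rewrite /m /batch_size -/L aE; congr natceil; apply/min_idPr; rewrite ge_max Nb1.
have mx1 : 1 <= Num.max 1 a by rewrite le_max lexx.
have am : a <= m%:R.
  by rewrite mE (le_trans _ (natceil_ge _))// le_max lexx orbT.
have m1 : 1 <= m%:R :> R by rewrite mE (le_trans mx1)// natceil_ge.
have m2 : m%:R <= 2 + 2 * a.
  have := natceil_lt (le_trans ler01 mx1); rewrite -mE.
  have : Num.max 1 a <= 1 + a by rewrite ge_max lerDl lerDr (ltW a0) ler01.
  have := mx1; lra.
split; first by rewrite -(ler1n R).
(* The constant part costs at most [eps * r ^+ 2 / 32] by the term with [128], and the part in [a]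
   at most [eps * r ^+ 2 / 8] by the term with [C2]. *)
- apply: (@le_trans _ _ (2 * L * D * (2 + 2 * a))).
    by rewrite ler_wpM2l// !mulr_ge0// (ltW L0).
  have k1 : D * C2 sigma Dt <= eps * r / 4.
    have : 0 < L * C3 sigma Dt by rewrite mulr_gt0.
    by move: h5; rewrite /T; lra.
  have k2 : D * sigma / e <= eps * r / 32.
    by move: k1; rewrite /C2 -/e; lra.
  have k3 : 2 * L * D * (2 * a) = 4 * (D * sigma / e) * r.
    by rewrite /a; field; rewrite !gt_eqF.
  have k4 : L * D <= eps * r ^+ 2 / 128.
    by move: h4; rewrite ler_pdivrMr//; lra.
  rewrite mulrDr k3 -r2; have := ler_wpM2r r_ge0 k2; nra.
(* Only the term with [C3] is used: it gives [6 * sigma ^+ 2 <= eps / 4 * a]. *)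
- apply: (@le_trans _ _ (eps / 4 * a)); last by rewrite ler_wpM2l// divr_ge0// ltW.
  have k1 : L * C3 sigma Dt <= eps * r / 4.
    have : 0 <= D * C2 sigma Dt by rewrite mulr_ge0// ltW.
    by move: h5; rewrite /T; lra.
  have k2 : L * e * (24 * sigma) <= eps * r by move: k1; rewrite /C3 -/e; lra.
  have -> : eps / 4 * a = eps * r * (sigma / (4 * L * e)).
    by rewrite /a; field; rewrite !gt_eqF.
  have k3 : sigma ^+ 2 <= L * e * (24 * sigma) * (sigma / (4 * L * e)).
    have -> : L * e * (24 * sigma) * (sigma / (4 * L * e)) = 6 * sigma ^+ 2.
      by field; rewrite !gt_eqF.
    have := sqr_ge0 sigma; lra.
  apply: (le_trans k3); rewrite ler_wpM2r// divr_ge0 ?(ltW sigma0)//.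
  by rewrite !mulr_ge0// ltW.
Qed.

Lemma Nin_bounds :
  2 * L * D <= eps / 4 * (natceil (Nb%:R / m%:R : R))%:R.
Proof.
have [m0 h _] := batch_size_bounds.
have mp : 0 < m%:R :> R by rewrite ltr0n.
apply: (@le_trans _ _ (eps / 4 * (Nb%:R / m%:R))); last first.
  by rewrite ler_wpM2l ?natceil_ge// divr_ge0// ltW.
by rewrite mulrA ler_pdivlMr.
Qed.

End BatchParams.

(** * Expected gap at the point returned by a call *)

Section Output.
Context {R : realType} (n q : nat).
Variables (f : 'rV[R]_n -> R) (c : 'rV[R]_n -> 'rV[R]_q) (flow Lg LJ : R).
Hypotheses (Lg0 : 0 < Lg) (LJ0 : 0 < LJ) (as1 : AS1 f c flow Lg LJ).
Variable (Phi_low : R -> R).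
Hypothesis Phi_lowP : forall rho : R, 0 < rho ->
       flow <= Phi_low rho /\ forall x, Phi_low rho <= Phi f c rho x.
Context dX (Xi : measurableType dX) (o : oracle R n Xi) (sigma Dt : R).
Hypotheses (sigma0 : 0 < sigma) (Dt0 : 0 < Dt).
Context d (Omega : measurableType d) (P : probability Omega R).
Variable (t : trajectory R n Xi Omega).
Variables (N : nat) (eps xi tau rho0 : R) (x1 G1 : 'rV[R]_n).
Hypotheses (eps0 : 0 < eps) (tau0 : 0 < tau) (rho0_ge1 : 1 <= rho0).
Let gamma (rho : R) := 1 / L_ Lg LJ rho.
Let batch := batch_size Lg LJ sigma Dt.
Hypothesis run : algP c P o gamma batch N eps xi tau rho0 x1 G1 t.
Hypothesis as4 : AS4 f o batch sigma N t.
Hypothesis Nbar_ge : forall k w, (0 < k < N)%N ->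
   Nbar_min Lg LJ sigma Dt eps (rho_ t k w)
     (Phi f c (rho_ t k w) (x_ t k w) - Phi_low (rho_ t k w))
   <= (Nbar_ t k w)%:R.

Lemma rho_lower_bound k w : (k < N)%N -> rho0 + k%:R * tau <= rho_ t k w.
Proof.
elim: k => [|k IH] kN; first by rewrite mul0r addr0 (algP_rho0 run).
have := IH (ltnW kN); have := algP_rho run w (k := k.+1); rewrite kN => /(_ isT) /=.
by rewrite -natr1 mulrDl mul1r; lra.
Qed.

Variable k : nat.
Hypothesis kN : (0 < k < N)%N.

Lemma rho_gt0 w : 0 < rho_ t k w.
Proof.
have /andP[_ kltN] := kN; have := rho_lower_bound w kltN.
apply: lt_le_trans; rewrite ltr_pwDl ?mulr_ge0 ?(ltW tau0)//.
exact: lt_le_trans rho0_ge1.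
Qed.

Let L w := L_ Lg LJ (rho_ t k w).

Lemma Phi_gap_ge0 w :
  0 <= Phi f c (rho_ t k w) (x_ t k w) - Phi_low (rho_ t k w).
Proof. by rewrite subr_ge0 (Phi_lowP (rho_gt0 w)).2. Qed.

Let bounds w := batch_size_bounds Lg0 LJ0 sigma0 Dt0 eps0 (rho_gt0 w)
  (Phi_gap_ge0 w) (Nbar_ge w kN).

Lemma m_gt0 w : (0 < m_ batch t k w)%N.
Proof. by have [] := bounds w. Qed.

Lemma measurable_m :
  measurable_fun setT (m_ batch t k : g_sigma_algebraType (past t k) -> nat).
Proof.
apply: (@measurable_fun_index _ (g_sigma_algebraType (past t k)) _ _ (Nbar_ t k)
  (fun a w => batch (rho_ t k w) a)) => [|a].
  exact: (measurable_Nbar kN).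
apply: (measurableT_comp measurable_natceil).
apply: measurable_minr => //; apply: measurable_maxr => //.
apply: measurable_funM => //; apply: measurable_funM => //.
(* The inverse is written as a power to use measurability of powers; both agree since [L] is
   positive. *)
rewrite (_ : (fun w => _) = (fun w => L w `^ (- 1))); last first.
  by apply/funext => w; rewrite powR_inv1// ltW// L_gt0// rho_gt0.
have mL : measurable_fun setT (L : g_sigma_algebraType (past t k) -> R).
  apply: measurable_funD => //; apply: measurable_funM => //.
  exact: (measurable_rho kN).
exact: (measurableT_comp (measurable_powR (-1)) mL).
Qed.

Let gapR w := gap f c Lg LJ o batch t k (R_ t k w) w.

Let aS := algP_algS run kN.

Lemma R_gt0 w : (0 < R_ t k w)%N.
Proof. by have /andP[] := algS_range aS w. Qed.

Lemma gapR_ge0 w : 0 <= gapR w.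
Proof. by rewrite (gap_ge0 Lg0 LJ0 as1 run kN rho_gt0)// R_gt0. Qed.

Lemma measurable_gapR : measurable_fun setT gapR.
Proof.
(* The index is written as a successor because [gap] is known to be measurable for positive [j]
   only. *)
rewrite (_ : gapR = fun w =>
    gap f c Lg LJ o batch t k (R_ t k w).-1.+1 w); last first.
  by apply/funext => w; rewrite prednK// R_gt0.
apply: (measurable_fun_index (algS_meas_R aS)
  (X := fun j w => gap f c Lg LJ o batch t k j.-1.+1 w)) => j.
apply: (measurable_fun_sub (past_call_measurable run kN)).
exact: (measurable_gap as1 o kN m_gt0 measurable_m).
Qed.

Local Open Scope ereal_scope.

Lemma integral_gapR : \int[P]_w (gapR w)%:E <= (eps / 2)%:E.
Proof.
(* One natural number encodes both parameters, so its level sets fix them together. *)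
pose code w := pickle (Nin batch t k w, m_ batch t k w).
have mcode : measurable_fun setT (code : g_sigma_algebraType (past t k) -> nat).
  apply: (@measurable_fun_index _ (g_sigma_algebraType (past t k)) _ _
    (Nin batch t k) (fun a w => pickle (a, m_ batch t k w))) => [|a].
    exact: (measurable_Nin kN measurable_m).
  apply: (@measurable_fun_index _ (g_sigma_algebraType (past t k)) _ _
    (m_ batch t k) (fun b _ => pickle (a, b))) => //.
  exact: measurable_m.
have pm := past_measurable run kN.
rewrite -[leRHS]mule1 -(probability_setT P) -(integral_cst P measurableT).
apply: (le_integral_index (measurable_fun_sub pm mcode)) => //.
- by apply/measurable_EFinP; exact: measurable_gapR.
- by move=> w; rewrite lee_fin gapR_ge0.
- by move=> w; rewrite lee_fin divr_ge0// ltW.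
move=> a; set A := code @^-1` [set a].
have [->|/set0P[w0 Aw0]] := eqVneq A set0; first by rewrite !integral_set0.
have AE w : A w -> Nin batch t k w = Nin batch t k w0
    /\ m_ batch t k w = m_ batch t k w0.
  rewrite /A /= => Aw; move: Aw0; rewrite /A /= -Aw => /(pcan_inj pickleK).
  by case=> -> ->.
have pA : <<s past t k >> A.
  by have := mcode measurableT [set a] I; rewrite setTI.
have mA := sub_sigma_algebra_measurable pm pA.
rewrite (integral_cst P mA) [X in _ <= X%:E * _](_ : _ = eps / 4 + eps / 4)%R; last by field.
apply: (integral_gap_const Lg0 LJ0 as1 run as4 kN rho_gt0 m_gt0 measurable_m
  (n0 := Nin batch t k w0) (m0 := m_ batch t k w0) (Plow := Phi_low)) => //.
- by have /andP[r0 rN] := algS_range aS w0; exact: leq_trans rN.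
- exact: m_gt0.
- by rewrite divr_ge0// ltW.
- by move=> rho x rho_gt0; exact: (Phi_lowP rho_gt0).2.
- by move=> w /AE[].
- by move=> w /AE[].
- move=> w /AE[<- _]; exact: (Nin_bounds Lg0 LJ0 sigma0 Dt0 eps0 (rho_gt0 w)
    (Phi_gap_ge0 w) (Nbar_ge w kN)).
- by have [] := bounds w0.
Qed.

End Output.

(** * Measurable multipliers *)

Section MeasurableMultiplier.
Context {R : realType}.

(** An enumeration of the rational vectors; an index that encodes none gives 0. *)
Definition ratvec q (i : nat) : 'rV[R]_q :=
  map_mx ratr (odflt 0 (unpickle i : option 'rV[rat]_q)).

Lemma ratvec_dense q (l : 'rV[R]_q) (e : R) : 0 < e ->
  exists i, enorm (ratvec q i - l) <= e.
Proof.
(* Dividing by [q.+1] covers [q = 0] as well. *)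
move=> e0; pose e' := e / q.+1%:R.
have e'0 : 0 < e' by rewrite divr_gt0.
have /choice[a ha] (j : 'I_q) : exists a : rat, `|ratr a - l ord0 j| <= e'.
  have [|a] := @rat_in_itvoo R (l ord0 j - e') (l ord0 j + e'); first by lra.
  by rewrite in_itv/= => /andP[h1 h2]; exists a; rewrite ler_norml; lra.
exists (pickle (\row_j a j : 'rV[rat]_q)); rewrite /ratvec pickleK /=.
apply: (le_trans (enorm_le_sum _)); apply: (@le_trans _ _ (\sum_(j < q) e')).
  by apply: ler_sum => j _; rewrite !mxE; exact: ha.
rewrite sumr_const card_ord -[_ *+ _]mulr_natl /e' mulrA ler_pdivrMr//.
by rewrite mulrC ler_wpM2l ?(ltW e0)// ler_nat.
Qed.

Lemma ratvec_approx n q (g : 'rV[R]_n) (A : 'M[R]_(q, n)) l (e : R) : 0 < e ->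
  exists i, enorm (g + ratvec q i *m A) ^+ 2 <= enorm (g + l *m A) ^+ 2 + e.
Proof.
move=> e0; set v := enorm (g + l *m A); set K := opnorm A.
have v0 : 0 <= v := enorm_ge0 _; have K0 : 0 <= K := opnorm_ge0 A.
have M0 : 0 < 2 * v * K + K ^+ 2 + 1 by rewrite ltr_wpDl ?addr_ge0 ?mulr_ge0 ?sqr_ge0.
(* As [h <= 1], the excess of [(v + K * h) ^+ 2] over [v ^+ 2] is at most
   [h * (2 * v * K + K ^+ 2)]; the summand 1 keeps the denominator positive. *)
pose h := Num.min 1 (e / (2 * v * K + K ^+ 2 + 1)).
have h0 : 0 < h by rewrite lt_min ltr01 divr_gt0.
have h1 : h <= 1 by rewrite ge_min lexx.
have hM : h * (2 * v * K + K ^+ 2 + 1) <= e.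
  by rewrite -ler_pdivlMr// ge_min lexx orbT.
have [i hi] := ratvec_dense l h0; exists i.
have -> : g + ratvec q i *m A = (g + l *m A) + (ratvec q i - l) *m A.
  by rewrite mulmxBl addrCA addrC addrK addrC.
have s0 := enorm_ge0 ((ratvec q i - l) *m A).
have sK : enorm ((ratvec q i - l) *m A) <= K * h.
  by rewrite (le_trans (enorm_mulmx _ _))// ler_wpM2l.
apply: (@le_trans _ _ ((v + K * h) ^+ 2)).
  rewrite lerXn2r ?nnegrE ?enorm_ge0 ?addr_ge0 ?mulr_ge0 ?(ltW h0)//.
  by rewrite (le_trans (ler_enormD _ _))// lerD2l.
have : K ^+ 2 * h * h <= K ^+ 2 * h * 1.
  by rewrite ler_wpM2l// mulr_ge0 ?sqr_ge0// ltW.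
move: hM; rewrite sqrrD; lra.
Qed.

Context d (Omega : measurableType d) (P : probability Omega R).

Lemma measurable_first_index (p : nat -> Omega -> bool)
    (ex : forall w, exists i, p i w) :
  (forall i, measurable [set w | p i w]) ->
  measurable_fun setT (fun w => ex_minn (ex w)).
Proof.
move=> mp _ B _; rewrite setTI.
have -> : (fun w => ex_minn (ex w)) @^-1` B = \bigcup_(k in B)
    ([set w | p k w] `&` \bigcap_(j in [set j | (j < k)%N]) ~` [set w | p j w]).
  apply/seteqP; split=> [w Bw|w [k Bk [/= pk pj]]].
    exists (ex_minn (ex w)) => //=; case: ex_minnP => k pk mink; split=> // j /= jk.
    by move=> /mink; rewrite leqNgt jk.
  rewrite /=; case: ex_minnP => k' pk' mink.
  suff -> : k' = k by [].
  apply/eqP; rewrite eqn_leq mink//= leqNgt; apply/negP => k'k.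
  exact: pj k'k pk'.
apply: bigcup_measurable => k _; apply: measurableI; first exact: mp.
by apply: bigcap_measurableType => j _; exact: measurableC.
Qed.

Local Open Scope ereal_scope.

(* As the expectation of [H] leaves a margin [eps / 2], the first rational
   multiplier that is optimal up to this margin will do, and it is measurable. *)
Lemma dual_feasible_of_bound n q (f : 'rV[R]_n -> R) (c : 'rV[R]_n -> 'rV[R]_q)
    (X : Omega -> 'rV[R]_n) (H : Omega -> R) (eps : R) :
  continuous (grad f) -> continuous (jacobian c) -> (0 < eps)%R ->
  measurable_fun setT (X : Omega -> borelRn R n) ->
  measurable_fun setT H -> (forall w, 0 <= H w)%R ->
  (forall w, exists l : 'rV[R]_q,
     enorm (grad f (X w) + l *m ('J c (X w))^T) ^+ 2 <= H w)%R ->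
  \int[P]_w (H w)%:E <= (eps / 2)%:E ->
  dual_feasible f c P eps X.
Proof.
move=> cg cJ eps0 mX mH H0 exl intH.
pose v l w := enorm (grad f (X w) + l *m ('J c (X w))^T)%R.
have mv l : measurable_fun setT (fun w => (v l w ^+ 2)%R).
  apply: measurable_sqr_enorm => i.
  under eq_fun => w do (rewrite mxE [X in (_ + X)%R]mxE;
    under eq_bigr => j _ do rewrite [X in (_ * X)%R]mxE).
  apply: measurable_funD.
    have mg := continuous_measurable_borelRn (continuous_grad_coord cg (i := i)).
    exact: (measurableT_comp mg mX).
  apply: measurable_sum => j; apply: measurable_funM => //.
  have cJij : continuous (fun x => 'J c x i j).
    by move=> x; exact: (cvg_comp _ _ (@cJ x) (@coord_continuous R n q i j ('J c x))).
  exact: (measurableT_comp (continuous_measurable_borelRn cJij) mX).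
pose p i w := (v (ratvec q i) w ^+ 2 <= H w + eps / 2)%R.
have ex w : exists i, p i w.
  have [l hl] := exl w.
  have e2 : (0 < eps / 2)%R by rewrite divr_gt0.
  have [i hi] := ratvec_approx (grad f (X w)) (('J c (X w))^T) l e2.
  by exists i; apply: (le_trans hi); rewrite lerD2r.
have mp i : measurable [set w | p i w].
  have mle : measurable_fun setT (p i).
    by apply: measurable_fun_ler => //; exact: measurable_funD.
  by have := mle measurableT [set true] I; rewrite setTI.
exists (fun w => ratvec q (ex_minn (ex w))); split.
  exact: (measurable_fun_index (measurable_first_index ex mp)
    (X := fun i _ => ratvec q i : borelRn R q)).
rewrite unlock; apply: (@le_trans _ _ (\int[P]_w (H w + eps / 2)%:E)).
  apply: ae_le_integral.
  - by move=> w; rewrite lee_fin sqr_ge0.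
  - by move=> w; rewrite lee_fin addr_ge0// divr_ge0// ltW.
  - by apply/measurable_EFinP; exact: measurable_funD.
  - by apply/aeW => w; rewrite lee_fin; case: ex_minnP.
under eq_integral do rewrite EFinD.
rewrite ge0_integralD//; last 3 first.
- by move=> w _; rewrite lee_fin.
- exact/measurable_EFinP.
- by move=> w _; rewrite lee_fin divr_ge0// ltW.
have -> : \int[P]_w (eps / 2)%:E = (eps / 2)%:E.
  by rewrite (integral_cst P measurableT) [X in _ * X]probability_setT mule1.
by rewrite [X in _ <= X%:E]splitr EFinD leeD2r.
Qed.

End MeasurableMultiplier.

(** * Rates *)

Section Rates.
Context {R : realType}.
Variables (Lg LJ kg kJ xi tau rho0 : R).
Hypotheses (Lg0 : 0 < Lg) (LJ0 : 0 < LJ) (kg0 : 0 < kg) (kJ0 : 0 < kJ)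
  (xi0 : 0 < xi) (xi1 : xi < 1) (tau0 : 0 < tau) (rho0_ge1 : 1 <= rho0).

Lemma Cbar_ge0 eps : 0 <= Cbar Lg LJ kg kJ eps.
Proof.
by rewrite addr_ge0 ?mulr_ge0 ?invr_ge0 ?sqrtr_ge0// ltW.
Qed.

Lemma kg_le_sqrt eps : 0 <= eps -> kg <= Num.sqrt (kg ^+ 2 + eps / 4).
Proof.
move=> eps0; rewrite -[leLHS](ger0_norm (ltW kg0)) -sqrtr_sqr ler_sqrt.
  by rewrite lerDl divr_ge0.
by rewrite addr_ge0 ?sqr_ge0// divr_ge0.
Qed.

Lemma Cbar_ge eps : 0 <= eps -> kJ / LJ + kg / Lg <= Cbar Lg LJ kg kJ eps.
Proof.
move=> eps0; rewrite /Cbar [LJ^-1 * _]mulrC [Lg^-1 * _]mulrC lerD2l.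
by rewrite ler_wpM2r ?invr_ge0 ?(ltW Lg0)// kg_le_sqrt.
Qed.

(** Every power of [eps] in the rates becomes an integer power of its fourth root, within reach of
    [field]. *)
Lemma powR_quarter (eps : R) : 0 < eps ->
  [/\ 0 < eps `^ (1 / 4), eps = (eps `^ (1 / 4)) ^+ 4,
      Num.sqrt eps = (eps `^ (1 / 4)) ^+ 2
    & eps `^ (- (1 / 2)) = (eps `^ (1 / 4)) ^- 2].
Proof.
move=> eps0; have s0 : 0 < eps `^ (1 / 4) by exact: powR_gt0.
have e4 : eps = (eps `^ (1 / 4)) ^+ 4.
  by rewrite -powR_mulrn ?(ltW s0)// -powRrM mul1r mulVf ?powRr1 ?ltW.
split => //.
  rewrite [in LHS]e4 -[4%N]/(2 * 2)%N exprM sqrtr_sqr ger0_norm//.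
  by rewrite exprn_ge0// ltW.
rewrite powRN; congr _^-1; rewrite -powR_mulrn ?(ltW s0)// -powRrM.
by congr (_ `^ _); field.
Qed.

(* Tangent lines at [g = eps] of [g^(1/2)] and [g^(1/4)] make the bound affine
   in [g], so that taking expectations requires no Jensen inequality. *)
Lemma theta_affine_bound (eps : R) N : 0 < eps -> eps < 1 -> (0 < N)%N ->
  exists a b, [/\ 0 <= a, 0 <= b,
    a + b * eps <= theta_bound Lg LJ kg kJ xi tau rho0 eps N &
    forall rho g th, rho0 + (N%:R - 1) * tau <= rho -> 0 <= g ->
      rho * th <= kg + 2 * Cbar Lg LJ kg kJ eps * Num.sqrt g
        + Num.sqrt (2 * Cbar Lg LJ kg kJ eps * Num.sqrt g * L_ Lg LJ rho) ->
      th <= a + b * g].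
Proof.
move=> eps0 eps1 N0; have [s0 e4 _ _] := powR_quarter eps0.
rewrite /theta_bound /=.
set s := eps `^ (1 / 4) in s0 e4 *; set C := Cbar _ _ _ _ _.
set rN := rho0 + (N%:R - 1) * tau; set E := Num.sqrt (kg ^+ 2 + _).
have C0 : 0 <= C := Cbar_ge0 eps.
have kgE : kg <= E := kg_le_sqrt (ltW eps0).
have N1 : 1 <= N%:R :> R by rewrite ler1n.
have rN1 : 1 <= rN.
  by rewrite (le_trans rho0_ge1)// lerDl mulr_ge0 ?subr_ge0// ltW.
have rN0 : 0 < rN by lra.
set r := Num.sqrt rN; have r0 : 0 < r by rewrite sqrtr_gt0.
have r2 : r ^+ 2 = rN by rewrite sqr_sqrtr// ltW.
have r1 : 1 <= r by rewrite -[leLHS]sqrtr1 ler_sqrt// ltW.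
have s1 : s <= 1.
  rewrite leNgt; apply/negP => s1; move: eps1.
  by rewrite e4 ltNge exprn_ege1// ltW.
set Q := Num.sqrt (2 * C) * Num.sqrt (Lg + LJ).
have Q0 : 0 <= Q by rewrite mulr_ge0 ?sqrtr_ge0.
set K := xi * r; have K0 : 0 < K by rewrite mulr_gt0.
set F := E / ((1 - xi) * rN).
have F0 : 0 <= F by rewrite divr_ge0 ?sqrtr_ge0// mulr_ge0 ?subr_ge0 ?ltW.
(* The terms in [C] come from [hb], those in [Q] from [zb], and [F] bounds [kg / rho]. *)
exists ((C * s ^+ 2 + 3 / 4 * Q * s) / K + F), ((C / s ^+ 2 + Q / (4 * s ^+ 3)) / K).
split.
- by rewrite addr_ge0// divr_ge0 ?(ltW K0)// addr_ge0 ?mulr_ge0 ?(ltW s0) ?sqr_ge0.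
- rewrite divr_ge0 ?(ltW K0)// addr_ge0// divr_ge0 ?sqr_ge0//.
  by rewrite mulr_ge0// exprn_ge0// ltW.
(* At [g = eps] the affine bound is [(2 * C * s ^+ 2 + Q * s) / K + F]; replacing [s ^+ 2] by the
   larger [s] puts the same factor on both terms. *)
- have -> : (C * s ^+ 2 + 3 / 4 * Q * s) / K + F
       + (C / s ^+ 2 + Q / (4 * s ^+ 3)) / K * eps
     = (2 * C * s ^+ 2 + Q * s) / K + F.
    by rewrite [in LHS]e4; field; rewrite !gt_eqF.
  rewrite lerD2r [leRHS]mulrAC ler_pM2r ?invr_gt0// [leRHS]mulrDl lerD2r.
  by rewrite ler_wpM2l ?mulr_ge0// expr2 ler_piMl// ltW.
move=> rho g th rho_ge g0 hth.
have rho0' : 0 < rho by lra.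
set h := Num.sqrt g in hth *; have h0 : 0 <= h := sqrtr_ge0 _.
have h2 : h ^+ 2 = g by rewrite sqr_sqrtr.
set z := Num.sqrt h; have z0 : 0 <= z := sqrtr_ge0 _.
have z2 : z ^+ 2 = h by rewrite sqr_sqrtr.
have hb : 2 * h <= s ^+ 2 + g / s ^+ 2.
  have : 0 <= (h - s ^+ 2) ^+ 2 / s ^+ 2 by rewrite divr_ge0 ?sqr_ge0.
  have -> : (h - s ^+ 2) ^+ 2 / s ^+ 2 = s ^+ 2 + g / s ^+ 2 - 2 * h.
    by rewrite -h2; field; rewrite !gt_eqF.
  lra.
have zb : z <= 3 / 4 * s + g / (4 * s ^+ 3).
  (* The product is [z ^+ 4 - 4 * s ^+ 3 * z + 3 * s ^+ 4]. *)
  have : 0 <= (z - s) ^+ 2 * (z ^+ 2 + 2 * z * s + 3 * s ^+ 2) / (4 * s ^+ 3).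
    have q1 : 0 <= z ^+ 2 + 2 * z * s + 3 * s ^+ 2.
      have := mulr_ge0 z0 (ltW s0); have := sqr_ge0 z; have := sqr_ge0 s; lra.
    by rewrite divr_ge0 ?(mulr_ge0 _ q1) ?sqr_ge0// mulr_ge0// exprn_ge0// ltW.
  have -> : (z - s) ^+ 2 * (z ^+ 2 + 2 * z * s + 3 * s ^+ 2) / (4 * s ^+ 3)
     = 3 / 4 * s + g / (4 * s ^+ 3) - z.
    by rewrite -h2 -z2; field; rewrite !gt_eqF.
  lra.
set p := Num.sqrt rho; have p0 : 0 < p by rewrite sqrtr_gt0.
have p2 : p ^+ 2 = rho by rewrite sqr_sqrtr// ltW.
have rp : r <= p by rewrite ler_sqrt// ltW.
(* As [rho >= 1], [L_] is at most [rho * (Lg + LJ)], which is where the factor [Lg + LJ] comes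
   from. *)
have sq : Num.sqrt (2 * C * h * L_ Lg LJ rho) <= Q * p * z.
  have -> : Q * p * z = Num.sqrt (2 * C * h * (rho * (Lg + LJ))).
    rewrite !sqrtrM ?mulr_ge0 ?(ltW rho0')// -/p -/z -/Q.
    by rewrite /Q !sqrtrM//; ring.
  rewrite ler_sqrt; last first.
    by rewrite !mulr_ge0 ?(ltW rho0')// addr_ge0 ?(ltW Lg0) ?(ltW LJ0).
  apply: ler_wpM2l; first by rewrite !mulr_ge0.
  have rho1 : 1 <= rho by lra.
  by have := ler_wpM2r (ltW Lg0) rho1; rewrite /L_; lra.
have thb : th <= (2 * C * h + Q * p * z + kg) / rho.
  by rewrite ler_pdivlMr//; lra.
apply: (le_trans thb).
have -> : (2 * C * h + Q * p * z + kg) / rho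
    = 2 * C * h / rho + Q * z / p + kg / rho.
  by rewrite -p2; field; rewrite !gt_eqF.
have b1 : 2 * C * h / rho <= C * (s ^+ 2 + g / s ^+ 2) / K.
  rewrite ler_pM ?mulr_ge0 ?invr_ge0 ?(ltW rho0')//.
    by have := ler_wpM2l C0 hb; lra.
  rewrite lef_pV2 ?posrE// (le_trans _ rho_ge)// -/rN -r2 expr2 ler_wpM2r ?(ltW r0)//.
  by rewrite (le_trans (ltW xi1)).
have b2 : Q * z / p <= Q * (3 / 4 * s + g / (4 * s ^+ 3)) / K.
  rewrite ler_pM ?mulr_ge0 ?invr_ge0 ?(ltW p0)//; first by rewrite ler_wpM2l.
  by rewrite lef_pV2 ?posrE// (le_trans _ rp)// ler_piMl ?ltW.
have b3 : kg / rho <= F.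
  rewrite ler_pM ?invr_ge0 ?(ltW kg0) ?(ltW rho0')// lef_pV2 ?posrE ?mulr_gt0 ?subr_gt0//.
  by rewrite (le_trans _ rho_ge)// ler_piMl ?(ltW rN0)// lerBlDr lerDl ltW.
have -> : (C * s ^+ 2 + 3 / 4 * Q * s) / K + F + (C / s ^+ 2 + Q / (4 * s ^+ 3)) / K * g
   = C * (s ^+ 2 + g / s ^+ 2) / K + Q * (3 / 4 * s + g / (4 * s ^+ 3)) / K + F.
  by field; rewrite !gt_eqF.
lra.
Qed.

(** [Nhat] is set so that [rN * s ^+ 2] is at least [Ctilde]. The two arguments of the maximum in
    [Ctilde] each make one term of [theta_bound] at most half of [Num.sqrt eps]. *)
Lemma theta_bound_le_sqrt (eps : R) N : 0 < eps -> (0 < N)%N ->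
  Nhat Lg LJ kg kJ xi tau rho0 eps <= N%:Z ->
  theta_bound Lg LJ kg kJ xi tau rho0 eps N <= Num.sqrt eps.
Proof.
move=> eps0 N0; have [s0 e4 es eV] := powR_quarter eps0.
rewrite /Nhat ceil_le_int eV es /theta_bound /=.
set s := eps `^ (1 / 4) in s0 e4 es eV *; set C := Cbar _ _ _ _ _.
set rN := rho0 + (N%:R - 1) * tau; set E := Num.sqrt (kg ^+ 2 + _).
have -> : N%:Z%:~R = N%:R :> R by [].
set T := Ctilde _ _ _ _ _ _ => hN.
have N1 : 1 <= N%:R :> R by rewrite ler1n.
have rN0 : 0 < rN.
  by rewrite ltr_pwDl ?mulr_ge0 ?subr_ge0 ?(ltW tau0)// (lt_le_trans ltr01).
have TN : T <= rN * s ^+ 2.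
  rewrite -ler_pdivrMr ?exprn_gt0//; have := ler_wpM2l (ltW tau0) hN.
  have -> : tau * (tau^-1 * T * s ^- 2 - tau^-1 * rho0 + 1)
      = T / s ^+ 2 - rho0 + tau by field; rewrite !gt_eqF.
  by rewrite /rN; lra.
set r := Num.sqrt rN; have r0 : 0 < r by rewrite sqrtr_gt0.
have r2 : r ^+ 2 = rN by rewrite sqr_sqrtr// ltW.
move: TN; rewrite /T /Ctilde ge_max -/C => /andP[h1 h2].
have C0 : 0 <= C := Cbar_ge0 eps.
set A := 2 * C + Num.sqrt (2 * C) * Num.sqrt (Lg + LJ).
have AE : 4 * C + Num.sqrt (8 * C) * Num.sqrt (Lg + LJ) = 2 * A.
  rewrite (_ : 8 * C = 2 ^+ 2 * (2 * C)); last by ring.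
  by rewrite sqrtrM ?sqr_ge0// sqrtr_sqr ger0_norm// /A; ring.
have A0 : 0 <= A by rewrite addr_ge0 ?mulr_ge0 ?sqrtr_ge0.
have EE : Num.sqrt (4 * kg ^+ 2 + eps) = 2 * E.
  rewrite (_ : 4 * kg ^+ 2 + eps = 2 ^+ 2 * (kg ^+ 2 + eps / 4)); last by field.
  by rewrite sqrtrM ?sqr_ge0// sqrtr_sqr ger0_norm.
have k1 : 2 * A <= xi * r * s.
  rewrite -(@ler_pXn2r _ 2)// ?nnegrE ?mulr_ge0 ?(ltW xi0) ?(ltW r0) ?(ltW s0)//.
  move: h1; rewrite AE ler_pdivrMr ?exprn_gt0// => /le_trans; apply.
  by rewrite -r2 !exprMn mulrC mulrA.
have k2 : 2 * E <= (1 - xi) * rN * s ^+ 2.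
  by move: h2; rewrite EE ler_pdivrMr ?subr_gt0//; lra.
have xi1' : 0 < 1 - xi by rewrite subr_gt0.
have j1 : A / (xi * r) * s <= s ^+ 2 / 2.
  rewrite mulrAC ler_pdivrMr ?mulr_gt0//.
  have := ler_wpM2r (ltW s0) k1; rewrite expr2; lra.
have j2 : E / ((1 - xi) * rN) <= s ^+ 2 / 2.
  by rewrite ler_pdivrMr ?mulr_gt0//; lra.
lra.
Qed.

End Rates.

Lemma theta_ge0 {R : realType} n q (c : 'rV[R]_n -> 'rV[R]_q) x : 0 <= theta c x.
Proof.
rewrite subr_ge0; apply: ge_inf; last first.
  by exists 0; rewrite /= ?enorm0// mul0mx addr0.
by exists 0 => _ [s _ <-]; exact: enorm_ge0.
Qed.

(** * Guarantees on the output of the penalty method *)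

Section Guarantees.
Context {R : realType} (n q : nat).
Variables (f : 'rV[R]_n -> R) (c : 'rV[R]_n -> 'rV[R]_q) (flow Lg LJ : R).
Hypotheses (Lg0 : 0 < Lg) (LJ0 : 0 < LJ) (as1 : AS1 f c flow Lg LJ).
Variable (Phi_low : R -> R).
Hypothesis Phi_lowP : forall rho : R, 0 < rho ->
       flow <= Phi_low rho /\ forall x, Phi_low rho <= Phi f c rho x.
Context dX (Xi : measurableType dX) (o : oracle R n Xi) (sigma Dt : R).
Hypotheses (sigma0 : 0 < sigma) (Dt0 : 0 < Dt).
Context d (Omega : measurableType d) (P : probability Omega R).
Variable (t : trajectory R n Xi Omega).
Variables (N : nat) (eps xi tau rho0 : R) (x1 G1 : 'rV[R]_n) (kf kc kg kJ : R).
Hypotheses (eps0 : 0 < eps) (eps1 : eps < 1) (N1 : (1 < N)%N).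
Hypotheses (xi0 : 0 < xi) (xi1 : xi < 1) (tau0 : 0 < tau) (rho0_ge1 : 1 <= rho0)
  (kg0 : 0 < kg) (kJ0 : 0 < kJ).
Let gamma (rho : R) := 1 / L_ Lg LJ rho.
Let batch := batch_size Lg LJ sigma Dt.
Hypothesis run : algP c P o gamma batch N eps xi tau rho0 x1 G1 t.
Hypothesis as4 : AS4 f o batch sigma N t.
Hypothesis bounded : bounded_iterates f c P kf kc kg kJ N t.
Hypothesis Nbar_ge : forall k w, (0 < k < N)%N ->
   Nbar_min Lg LJ sigma Dt eps (rho_ t k w)
     (Phi f c (rho_ t k w) (x_ t k w) - Phi_low (rho_ t k w))
   <= (Nbar_ t k w)%:R.

(** The guarantees on the output come from the last call, whose penalty parameter is at least
    [rho0 + (N - 1) * tau]. *)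
Let k := N.-1.
Let kN : (0 < k < N)%N. Proof. by rewrite /k; case: N N1 => [|[|N']] //=. Qed.
Let NE : N = k.+1. Proof. by rewrite /k prednK// ltnW. Qed.
Let aS := algP_algS run kN.
Let rho_pos w : 0 < rho_ t k w := rho_gt0 tau0 rho0_ge1 run kN w.
Let H w := gap f c Lg LJ o batch t k (R_ t k w) w.
Let L w := L_ Lg LJ (rho_ t k w).

Let H_ge0 w : 0 <= H w.
Proof. exact: (gapR_ge0 Lg0 LJ0 as1 tau0 rho0_ge1 run kN). Qed.

Let mH : measurable_fun setT H.
Proof.
exact: (measurable_gapR Lg0 LJ0 as1 Phi_lowP sigma0 Dt0 eps0 tau0 rho0_ge1
  run Nbar_ge kN).
Qed.

Let intH : (\int[P]_w (H w)%:E <= (eps / 2)%:E)%E.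
Proof.
exact: (integral_gapR Lg0 LJ0 as1 Phi_lowP sigma0 Dt0 eps0 tau0 rho0_ge1
  run as4 Nbar_ge kN).
Qed.

Let decrease w :
  prox_decrease_le f c Lg LJ (rho_ t k w) (x_ t N w) (H w / (2 * L w)).
Proof.
rewrite NE (algP_x run w kN).
exact: (gapP Lg0 LJ0 as1 run kN rho_pos w (R_gt0 run kN w)).
Qed.

Let HE w : 2 * L w * (H w / (2 * L w)) = H w.
Proof. by rewrite mulrC mulfVK// gt_eqF// mulr_gt0// L_gt0. Qed.

Let mx : measurable_fun setT (x_ t N : Omega -> borelRn R n).
Proof.
rewrite (_ : x_ t N = fun w => y_ t k (R_ t k w).-1.+1 w); last first.
  by apply/funext => w; rewrite prednK ?(R_gt0 run kN)// NE (algP_x run w kN).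
apply: (measurable_fun_index (algS_meas_R aS)
  (X := fun j w => y_ t k j.-1.+1 w : borelRn R n)) => j.
exact: (algS_meas_y aS).
Qed.

Lemma output_dual_feasible : dual_feasible f c P eps (x_ t N).
Proof.
apply: (dual_feasible_of_bound (AS1_cgrad as1) (AS1_cjac as1) eps0 mx mH) => // w.
have [l hl] := prox_decrease_dual Lg0 LJ0 (ltW (rho_pos w)) (@decrease w).
by exists l; rewrite -[leRHS]HE.
Qed.

Lemma output_theta : ('E_P[fun w => theta c (x_ t N w)]
  <= (theta_bound Lg LJ kg kJ xi tau rho0 eps N)%:E)%E.
Proof.
have [a [b [a0 b0 ab H_aff]]] :=
  theta_affine_bound Lg0 LJ0 kg0 kJ0 xi0 xi1 tau0 rho0_ge1 eps0 eps1 (ltnW N1).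
have hC : kJ / LJ + kg / Lg <= Cbar Lg LJ kg kJ eps.
  by apply: Cbar_ge => //; exact: ltW.
rewrite unlock; apply: (@le_trans _ _ (\int[P]_w (a + b * H w)%:E)%E).
  apply: ae_le_integral.
  - by move=> w; rewrite lee_fin theta_ge0.
  - by move=> w; rewrite lee_fin addr_ge0// mulr_ge0.
  - apply/measurable_EFinP; apply: measurable_funD => //.
    exact: measurable_funM.
  apply: filterS bounded.2 => w /(_ N); rewrite leqnn (ltnW N1).
  move=> /(_ isT)[_ _ gk Jk]; rewrite lee_fin.
  apply: (H_aff (rho_ t k w)) => //.
    have := rho_lower_bound run w (proj2 (andP kN)).
    by rewrite [in N%:R - 1]NE -natr1 addrK.
  have := prox_decrease_theta Lg0 LJ0 (ltW (rho_pos w)) (@decrease w)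
    (ltW kg0) (ltW kJ0) gk Jk hC.
  by rewrite HE.
under eq_integral do rewrite EFinD EFinM.
rewrite ge0_integralD//; last 2 first.
- by move=> w _; rewrite mule_ge0// lee_fin.
- by apply: measurable_funeM; exact/measurable_EFinP.
rewrite ge0_integralZl_EFin//; last 2 first.
- by move=> w _; rewrite lee_fin.
- exact/measurable_EFinP.
rewrite (integral_cst P measurableT) [X in (a%:E * X)%E]probability_setT mule1.
apply: (@le_trans _ _ (a%:E + b%:E * (eps / 2)%:E)%E).
  by rewrite leeD2l// lee_wpmul2l.
rewrite -EFinM -EFinD lee_fin (le_trans _ ab)// lerD2l ler_wpM2l//.
by rewrite ler_pdivrMr// ler_peMr ?ler1n// ltW.
Qed.

Lemma output_critical : Nhat Lg LJ kg kJ xi tau rho0 eps <= N%:Z ->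
  stoch_critical f c P eps (x_ t N).
Proof.
move=> hN; split; first exact: output_dual_feasible.
apply: (le_trans output_theta); rewrite lee_fin.
exact: theta_bound_le_sqrt (ltnW N1) hN.
Qed.

End Guarantees.

(** * Number of oracle calls *)

Section Complexity.
Context {R : realType}.
Variables (Lg LJ sigma Dt : R).
Hypotheses (Lg0 : 0 < Lg) (LJ0 : 0 < LJ) (sigma0 : 0 < sigma) (Dt0 : 0 < Dt).

(** Rounding up the number of iterations overshoots [Nb] by less than one batch, and a batch has at
    most [Nb] samples. *)
Lemma calls_le_Nbar (rho : R) (Nb r : nat) : 0 < rho ->
  (r <= natceil (Nb%:R / (batch_size Lg LJ sigma Dt rho Nb)%:R : R))%N ->
  (r * batch_size Lg LJ sigma Dt rho Nb <= 2 * Nb)%N.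
Proof.
move=> rho_gt0; set m := batch_size _ _ _ _ _ _ => hr.
have mNb : (m <= Nb)%N.
  rewrite /m /batch_size; apply: natceil_le_nat; first by rewrite ge_min lexx.
  by rewrite le_min ler0n le_max ler01.
have [->|m0] := posnP m; first by rewrite muln0.
have mp : 0 < m%:R :> R by rewrite ltr0n.
rewrite -(ler_nat R) natrM.
have : r%:R < Nb%:R / m%:R + 1 :> R.
  apply: le_lt_trans (natceil_lt _); last by rewrite divr_ge0.
  by rewrite ler_nat.
move=> /ltW /(ler_wpM2r (ltW mp)) /le_trans; apply.
by rewrite mulrDl mul1r divfK ?gt_eqF// mul2n -addnn natrD lerD2l ler_nat.
Qed.

Variables (flow kf kc B : R).
Hypothesis (kc0 : 0 < kc).

(** In terms of [u = eps^(-1/2)], a penalty parameter of order [u] makes both [L] and [D] of order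
    [u]. The squared term is then of order [u^2 * u^4], the next one [u^4], and the last one is
    bounded. *)
Lemma Nbar_min_rate : exists2 M : R, 0 <= M &
  forall u eps rho D, 1 <= u -> eps = u ^- 2 -> 1 <= rho -> rho <= B * u ->
    0 <= D -> D <= kf + rho * kc - flow ->
    Nbar_min Lg LJ sigma Dt eps rho D <= M * u ^+ 6.
Proof.
pose D1 := `|kf - flow| + `|B| * kc; pose L1 := Lg + `|B| * LJ.
have D10 : 0 <= D1 by rewrite addr_ge0// mulr_ge0// ltW.
have L10 : 0 <= L1 by rewrite addr_ge0 ?mulr_ge0// ltW.
have c20 : 0 <= C2 sigma Dt by rewrite divr_ge0 ?mulr_ge0 ?sqrtr_ge0// ltW.
have c30 : 0 <= C3 sigma Dt by rewrite !mulr_ge0 ?sqrtr_ge0// ltW.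
have c10 : 0 <= C1 sigma Dt by rewrite divr_ge0 ?sqr_ge0// ltW.
pose T1 := 4 * D1 * C2 sigma Dt + 4 * L1 * C3 sigma Dt.
exists (T1 ^+ 2 + 128 * L1 * D1 + C1 sigma Dt / Lg ^+ 2).
  by rewrite (addr_ge0 _ (divr_ge0 c10 (sqr_ge0 _)))// addr_ge0 ?sqr_ge0// !mulr_ge0.
move=> u eps rho D u1 epsE rho1 rhoB D0 DB.
have u0 : 0 < u by lra.
have rhoB' : rho <= `|B| * u.
  by rewrite (le_trans rhoB)// ler_wpM2r ?ler_norm// ltW.
have DD : D <= D1 * u.
  apply: (le_trans DB); have := ler_wpM2r (ltW kc0) rhoB'.
  have : kf - flow <= `|kf - flow| * u.
    by rewrite (le_trans (ler_norm _))// ler_peMr.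
  by rewrite /D1; lra.
set L := L_ Lg LJ rho; have LL : L <= L1 * u.
  have := ler_wpM2r (ltW LJ0) rhoB'; have : Lg <= Lg * u by rewrite ler_peMr ?(ltW Lg0).
  by rewrite /L /L1 /L_; lra.
have rhoLJ : 0 <= rho * LJ by rewrite mulr_ge0 ?(ltW LJ0)//; lra.
have LgL : Lg <= L by rewrite /L /L_ lerDl.
have L0 : 0 < L := lt_le_trans Lg0 LgL.
have eV : eps^-1 = u ^+ 2 by rewrite epsE invrK.
have t1 : 4 * D * C2 sigma Dt + 4 * L * C3 sigma Dt <= T1 * u.
  have := ler_wpM2r c20 DD; have := ler_wpM2r c30 LL; rewrite /T1; lra.
have t0 : 0 <= 4 * D * C2 sigma Dt + 4 * L * C3 sigma Dt.
  have := mulr_ge0 D0 c20; have := mulr_ge0 (ltW L0) c30; lra.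
have b1 : (4 * D * C2 sigma Dt + 4 * L * C3 sigma Dt) ^+ 2 / eps ^+ 2
    <= T1 ^+ 2 * u ^+ 6.
  rewrite -exprVn eV (_ : T1 ^+ 2 * u ^+ 6 = (T1 * u) ^+ 2 * (u ^+ 2) ^+ 2); last by ring.
  by rewrite ler_wpM2r ?sqr_ge0// lerXn2r// nnegrE (le_trans t0).
have b2 : 128 * L * D / eps <= 128 * L1 * D1 * u ^+ 6.
  apply: (@le_trans _ _ (128 * L1 * D1 * u ^+ 4)).
    rewrite eV (_ : 128 * L1 * D1 * u ^+ 4 = 128 * ((L1 * u) * (D1 * u)) * u ^+ 2); last by ring.
    by rewrite ler_wpM2r ?sqr_ge0// -mulrA ler_wpM2l// ler_pM// ltW.
  by rewrite ler_wpM2l ?mulr_ge0// ler_weXn2l.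
have b3 : C1 sigma Dt / L ^+ 2 <= C1 sigma Dt / Lg ^+ 2 * u ^+ 6.
  apply: (@le_trans _ _ (C1 sigma Dt / Lg ^+ 2)).
    by rewrite ler_wpM2l// lef_pV2 ?posrE ?exprn_gt0// lerXn2r ?nnegrE ?(ltW Lg0) ?(ltW L0).
  by rewrite ler_peMr ?exprn_ege1// divr_ge0 ?sqr_ge0.
have n1 : 0 <= T1 ^+ 2 * u ^+ 6 by rewrite mulr_ge0 ?sqr_ge0// exprn_ge0// ltW.
have n2 : 0 <= 128 * L1 * D1 * u ^+ 6.
  by rewrite mulr_ge0 ?exprn_ge0 ?(ltW u0)// !mulr_ge0.
have n3 : 0 <= C1 sigma Dt / Lg ^+ 2 * u ^+ 6.
  by rewrite mulr_ge0 ?exprn_ge0 ?(ltW u0)// divr_ge0 ?sqr_ge0.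
by rewrite !mulrDl /Nbar_min ge_max -/L; apply/andP; split; lra.
Qed.

Variables (kg kJ xi tau rho0 : R).
Hypotheses (kJ0 : 0 < kJ) (xi1 : xi < 1) (tau0 : 0 < tau)
  (rho0_ge1 : 1 <= rho0).

Lemma Nhat_rate : exists2 M : R, 0 <= M &
  forall u eps N, 1 <= u -> 0 < eps -> eps < 1 -> eps `^ (- (1 / 2)) = u ->
    N%:Z = Num.max 2 (Nhat Lg LJ kg kJ xi tau rho0 eps) -> N%:R <= M * u.
Proof.
(* [Ctilde] increases with [eps], so its value at 1 bounds it for all tolerances considered. *)
pose T := Ctilde Lg LJ kg kJ xi 1.
have T0 : 0 <= T.
  by rewrite le_max divr_ge0 ?sqr_ge0.
exists (tau^-1 * T + 2); first by rewrite addr_ge0// mulr_ge0// invr_ge0 ltW.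
move=> u eps N u1 eps0 eps1 uE NE.
have TT : Ctilde Lg LJ kg kJ xi eps <= T.
  have CC : Cbar Lg LJ kg kJ eps <= Cbar Lg LJ kg kJ 1.
    rewrite /Cbar lerD2l ler_wpM2l ?invr_ge0 ?(ltW Lg0)// ler_sqrt; last first.
      by rewrite addr_ge0 ?sqr_ge0.
    by rewrite lerD2l ler_pM2r ?invr_gt0// ltW.
  have C0 : 0 <= Cbar Lg LJ kg kJ eps by exact: Cbar_ge0.
  have C0' : 0 <= Cbar Lg LJ kg kJ 1 by exact: Cbar_ge0.
  rewrite /T /Ctilde ge_max; apply/andP; split; rewrite le_max; apply/orP.
    left; rewrite ler_wpM2r ?invr_ge0 ?sqr_ge0// lerXn2r ?nnegrE//.
    - by rewrite addr_ge0 ?mulr_ge0 ?sqrtr_ge0.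
    - by rewrite addr_ge0 ?mulr_ge0 ?sqrtr_ge0.
    - by rewrite lerD ?ler_wpM2l ?ler_wpM2r ?sqrtr_ge0// ler_sqrt ?ler_wpM2l// mulr_ge0.
  right; rewrite ler_wpM2r ?invr_ge0 ?subr_ge0 ?(ltW xi1)// ler_sqrt.
    by rewrite lerD2l ltW.
  by rewrite addr_ge0// mulr_ge0// sqr_ge0.
have tT : 0 <= tau^-1 * T by rewrite mulr_ge0 ?invr_ge0 ?(ltW tau0).
have Nh : (Nhat Lg LJ kg kJ xi tau rho0 eps)%:~R <= tau^-1 * T * u + 2.
  have /andP[+ _] := ceil_itv (tau^-1 * Ctilde Lg LJ kg kJ xi eps * eps `^ (- (1 / 2))
     - tau^-1 * rho0 + 1).
  rewrite -/(Nhat _ _ _ _ _ _ _ _) intrB uE => h.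
  have : tau^-1 * Ctilde Lg LJ kg kJ xi eps * u <= tau^-1 * T * u.
    by rewrite ler_wpM2r ?(le_trans ler01)// ler_wpM2l// invr_ge0 ltW.
  have : 0 <= tau^-1 * rho0.
    by rewrite mulr_ge0 ?invr_ge0 ?(ltW tau0)// (le_trans ler01).
  lra.
have -> : N%:R = (N%:Z)%:~R :> R by [].
have tTu : 0 <= tau^-1 * T * u by rewrite mulr_ge0// (le_trans ler01).
by rewrite NE maxEle; case: ifP => _; lra.
Qed.

End Complexity.

Theorem theorem3p1 (R : realType) (n q : nat)
    (f : 'rV[R]_n -> R) (c : 'rV[R]_n -> 'rV[R]_q) (flow Lg LJ : R)
    (Phi_low : R -> R)
    (dX : measure_display) (Xi : measurableType dX) (o : oracle R n Xi)
    (sigma Dt xi tau rho0 : R) (x1 G1 : 'rV[R]_n) (kf kc kg kJ : R)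
    (Lg_gt0 : 0 < Lg) (LJ_gt0 : 0 < LJ) (as1 : AS1 f c flow Lg LJ)
    (Phi_lowP : forall rho : R, 0 < rho ->
       flow <= Phi_low rho /\ forall x, Phi_low rho <= Phi f c rho x)
    (sigma_gt0 : 0 < sigma) (Dt_gt0 : 0 < Dt)
    (xi_gt0 : 0 < xi) (xi_lt1 : xi < 1) (tau_gt0 : 0 < tau)
    (rho0_ge1 : 1 <= rho0)
    (kf_gt0 : 0 < kf) (kc_gt0 : 0 < kc) (kg_gt0 : 0 < kg) (kJ_gt0 : 0 < kJ) :
  let gamma := fun rho : R => 1 / L_ Lg LJ rho in
  let batch := batch_size Lg LJ sigma Dt in
  (forall (eps : R) (N : nat) (d : measure_display) (Omega : measurableType d)
      (P : probability Omega R) (t : trajectory R n Xi Omega),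
    0 < eps -> eps < 1 -> (1 < N)%N ->
    algP c P o gamma batch N eps xi tau rho0 x1 G1 t ->
    AS4 f o batch sigma N t ->
    bounded_iterates f c P kf kc kg kJ N t ->
    (forall k w, (0 < k < N)%N ->
       Nbar_min Lg LJ sigma Dt eps (rho_ t k w)
         (Phi f c (rho_ t k w) (x_ t k w) - Phi_low (rho_ t k w))
       <= (Nbar_ t k w)%:R) ->
    [/\ ('E_P[fun w => theta c (x_ t N w)]
           <= (theta_bound Lg LJ kg kJ xi tau rho0 eps N)%:E)%E,
        dual_feasible f c P eps (x_ t N)
      & Nhat Lg LJ kg kJ xi tau rho0 eps <= N%:Z ->
        stoch_critical f c P eps (x_ t N)]) /\
  (forall B : R, exists K : R,
    forall (eps : R) (N : nat) (d : measure_display) (Omega : measurableType d)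
      (P : probability Omega R) (t : trajectory R n Xi Omega),
    0 < eps -> eps < 1 ->
    N%:Z = Num.max 2 (Nhat Lg LJ kg kJ xi tau rho0 eps) ->
    algP c P o gamma batch N eps xi tau rho0 x1 G1 t ->
    AS4 f o batch sigma N t ->
    bounded_iterates f c P kf kc kg kJ N t ->
    (forall k w, (0 < k < N)%N ->
       Nbar_ t k w = natceil (Nbar_min Lg LJ sigma Dt eps (rho_ t k w)
         (Phi f c (rho_ t k w) (x_ t k w) - Phi_low (rho_ t k w)))) ->
    {ae P, forall w, forall k, (0 < k < N)%N ->
       rho_ t k w <= B * eps `^ (- (1 / 2))} ->
    stoch_critical f c P eps (x_ t N) /\
    {ae P, forall w,
       (oracle_calls batch N t w)%:R <= K * eps `^ (- (7 / 2))}).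
Proof.
move=> gamma batch; split.
  move=> eps N d Omega P t eps0 eps1 N1 run as4 bounded Nbar_ge; split.
  - exact: (output_theta Lg_gt0 LJ_gt0 as1 Phi_lowP sigma_gt0 Dt_gt0 eps0 eps1 N1
      xi_gt0 xi_lt1 tau_gt0 rho0_ge1 kg_gt0 kJ_gt0 run as4 bounded Nbar_ge).
  - exact: (output_dual_feasible Lg_gt0 LJ_gt0 as1 Phi_lowP sigma_gt0 Dt_gt0 eps0
      N1 tau_gt0 rho0_ge1 run as4 Nbar_ge).
  - exact: (output_critical Lg_gt0 LJ_gt0 as1 Phi_lowP sigma_gt0 Dt_gt0 eps0 eps1 N1
      xi_gt0 xi_lt1 tau_gt0 rho0_ge1 kg_gt0 kJ_gt0 run as4 bounded Nbar_ge).
move=> B.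
have [M1 M10 Nbar_rate] :=
  Nbar_min_rate Lg_gt0 LJ_gt0 sigma_gt0 Dt_gt0 flow kf B kc_gt0.
have [M2 M20 N_rate] :=
  Nhat_rate Lg_gt0 LJ_gt0 kg kJ_gt0 xi_lt1 tau_gt0 rho0_ge1.
(* There are fewer than [M2 * u] calls of the inner method, each with at most twice [Nbar_] oracle
   calls; the summand 1 absorbs the rounding of [Nbar_min], as [1 <= u ^+ 6]. *)
exists (M2 * (2 * (M1 + 1))).
move=> eps N d Omega P t eps0 eps1 NE run as4 bounded NbarE rhoB.
have N2 : 2 <= N%:Z by rewrite NE le_max lexx.
have N1 : (1 < N)%N by [].
have Nbar_ge k w : (0 < k < N)%N -> Nbar_min Lg LJ sigma Dt eps (rho_ t k w)
    (Phi f c (rho_ t k w) (x_ t k w) - Phi_low (rho_ t k w))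
    <= (Nbar_ t k w)%:R.
  by move=> kN; rewrite NbarE// natceil_ge.
split.
  apply: (output_critical Lg_gt0 LJ_gt0 as1 Phi_lowP sigma_gt0 Dt_gt0 eps0 eps1 N1
      xi_gt0 xi_lt1 tau_gt0 rho0_ge1 kg_gt0 kJ_gt0 run as4 bounded Nbar_ge).
  by rewrite NE le_max lexx orbT.
have [s0 e4 _ eV] := powR_quarter eps0.
set u := eps `^ (- (1 / 2)) in eV rhoB.
have eu : eps = u ^- 2.
  by rewrite eV [LHS]e4 exprVn invrK -exprM.
have u0 : 0 < u by exact: powR_gt0.
have u1 : 1 <= u.
  rewrite leNgt; apply/negP => u1; move: eps1; rewrite eu.
  by rewrite invf_lt1 ?exprn_gt0// ltNge exprn_ile1// ltW.
have u7 : eps `^ (- (7 / 2)) = u ^+ 7.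
  by rewrite /u -powR_mulrn ?powR_ge0// -powRrM; congr (_ `^ _); field.
have NM : N%:R <= M2 * u by exact: (N_rate u eps N u1 eps0 eps1).
rewrite u7; apply: filterS2 bounded.2 rhoB => w bw rw.
rewrite /oracle_calls natr_sum.
have call k : (0 < k < N)%N ->
    (R_ t k w * m_ batch t k w)%:R <= 2 * (M1 + 1) * u ^+ 6.
  move=> kN; have /andP[k0 kltN] := kN.
  have rho_gt := rho_gt0 tau_gt0 rho0_ge1 run kN w.
  have rho_ge1 : 1 <= rho_ t k w.
    apply: le_trans (rho_lower_bound run w kltN).
    by rewrite (le_trans rho0_ge1)// lerDl mulr_ge0// ltW.
  have [fk ck _ _] : [/\ f (x_ t k w) <= kf, enorm (c (x_ t k w)) <= kc,
      enorm (grad f (x_ t k w)) <= kg & opnorm ('J c (x_ t k w)) <= kJ].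
    by apply: bw; rewrite k0 ltnW.
  set D := Phi f c (rho_ t k w) (x_ t k w) - Phi_low (rho_ t k w).
  have [low_ge low_le] := Phi_lowP _ rho_gt.
  have D0 : 0 <= D by rewrite subr_ge0.
  have DB : D <= kf + rho_ t k w * kc - flow.
    have := ler_wpM2l (ltW rho_gt) ck; rewrite /D /Phi; lra.
  have Nb := Nbar_rate u eps _ D u1 eu rho_ge1 (rw _ kN) D0 DB.
  have mn0 : 0 <= Nbar_min Lg LJ sigma Dt eps (rho_ t k w) D.
    by rewrite le_max [X in _ || X]divr_ge0 ?sqr_ge0 ?orbT// divr_ge0 ?sqr_ge0// ltW.
  have NbR : (Nbar_ t k w)%:R <= (M1 + 1) * u ^+ 6.
    rewrite NbarE//; apply: (le_trans (ltW (natceil_lt mn0))).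
    by rewrite mulrDl mul1r lerD// exprn_ege1.
  have /andP[_ RN] := algS_range (algP_algS run kN) w.
  have := calls_le_Nbar rho_gt RN.
  rewrite -(ler_nat R) => /le_trans; apply.
  by rewrite natrM -mulrA ler_wpM2l.
apply: (@le_trans _ _ (\sum_(1 <= k < N) 2 * (M1 + 1) * u ^+ 6)).
  by rewrite big_nat [leRHS]big_nat; apply: ler_sum => k kN; exact: call.
rewrite sumr_const_nat -[_ *+ _]mulr_natl.
have c0 : 0 <= 2 * (M1 + 1) * u ^+ 6.
  by rewrite mulr_ge0 ?exprn_ge0 ?(ltW u0)// mulr_ge0// addr_ge0.
apply: (@le_trans _ _ (M2 * u * (2 * (M1 + 1) * u ^+ 6))).
  by rewrite ler_wpM2r// (le_trans _ NM)// ler_nat leq_subr.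
by rewrite le_eqVlt; apply/orP; left; apply/eqP; ring.
Qed.
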